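(* Let $k,\ell,n$ be positive integers with $k\ge\ell$ and $k+2\ell-5\le n<(k-1)(\ell-1)$. Then $s^{(b)}_n(k,\ell)<s^{(b)}_{n+1}(k,\ell)$, where $s^{(b)}_m(k,\ell)$ denotes the number of $(k,\ell)$-bicrucial permutations of length $m$.
   Context: $i_m=12\cdots m$ and $d_m=m(m-1)\cdots 1$; a permutation (in one-line notation) contains $i_m$ (resp. $d_m$) if it has an increasing (resp. decreasing) subsequence of length $m$, and avoids it otherwise. For $1\le t\le n+1$ put $e_t(x)=x$ if $x<t$ and $e_t(x)=x+1$ if $x\ge t$. The extensions of a permutation $\sigma=\sigma_1\cdots\sigma_n$ of $\{1,\ldots,n\}$ to the right are $e_t(\sigma_1)\cdots e_t(\sigma_n)\,t$, and to the left are $t\,e_t(\sigma_1)\cdots e_t(\sigma_n)$, for $1\le t\le n+1$. A permutation is $(k,\ell)$-bicrucial if it avoids $i_k$ and $d_\ell$ but each of its extensions to the right and each of its extensions to the left contains $i_k$ or $d_\ell$. *)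

(* Defs.v *)
From mathcomp Require Import all_boot all_fingroup.

Set Implicit Arguments.
Unset Strict Implicit.
Unset Printing Implicit Defensive.

(* Permutations of {1, ..., n} are elements of 'S_n, with positions and values
   shifted down by one. *)

Definition contains_incr (n m : nat) (s : 'S_n) : bool :=
  [exists f : {ffun 'I_m -> 'I_n}, forall i : 'I_m, forall j : 'I_m,
     (i < j) ==> (f i < f j) && (s (f i) < s (f j))].

Definition contains_decr (n m : nat) (s : 'S_n) : bool :=
  [exists f : {ffun 'I_m -> 'I_n}, forall i : 'I_m, forall j : 'I_m,
     (i < j) ==> (f i < f j) && (s (f j) < s (f i))].

Definition contains_id_or_rev (k l n : nat) (s : 'S_n) : bool :=
  contains_incr k s || contains_decr l s.

(* lift_perm p t s puts the value t at position p, and raises by one every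
   value of s that is at least t: lift t x is x + (t <= x). *)
Definition ext_right (n : nat) (s : 'S_n) (t : 'I_n.+1) : 'S_n.+1 :=
  lift_perm ord_max t s.

Definition ext_left (n : nat) (s : 'S_n) (t : 'I_n.+1) : 'S_n.+1 :=
  lift_perm ord0 t s.

Definition bicrucial (k l n : nat) (s : 'S_n) : bool :=
  [&& ~~ contains_incr k s,
      ~~ contains_decr l s,
      [forall t, contains_id_or_rev k l (ext_right s t)]
    & [forall t, contains_id_or_rev k l (ext_left s t)]].

Definition num_bicrucial (k l n : nat) : nat :=
  #|[set s : 'S_n | bicrucial k l s]|.

(* Main.v *)
Require Import Defs.
From mathcomp Require Import all_boot all_fingroup.
From mathcomp Require Import zify.

(** Put [K = k - 1] and [L = l - 1]. A permutation is handled as a word whose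
    letters are distinct odd numbers, and an extension as one more letter, even,
    placed before or after the word: only the relative order of letters matters.

    Being bicrucial depends only on the plactic class of the word. Indeed a Knuth
    move performed inside a longer word changes neither its increasing nor its
    decreasing subsequences as far as lengths are concerned ([chain_knuth1],
    [chain_knuth2]), and row insertion is a sequence of Knuth moves
    ([step_chain_equiv]). So a word is bicrucial exactly when the reading word of
    its Robinson-Schensted tableau is. Moreover the property passes from a word to
    any longer word containing it, as long as both patterns are still avoided
    ([bicrucial_word_mono]). Avoidance means that the tableau fits in a rectangle
    with [L] rows and [K] columns ([avoids_shape]). Hence, if [T] is the tableau of
    a bicrucial word of length [n < K * L], then adding a new maximum to [T] in a
    free place of the rectangle gives a tableau [T'] all of whose words are
    bicrucial.

    The number of words with a given tableau depends only on its shape, and is the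
    sum of the same numbers over the shapes with one corner removed
    ([words_size_row_len], [words_sum]), because insertion can be undone from any
    corner. Therefore [T'] has at least as many words as [T], and matching the two
    lists of words in order gives an injection from bicrucial words of length [n]
    to those of length [n + 1]: [T'] determines [T], by deleting its maximum.

    The inequality is strict for one of two reasons. If [n + 1 < K * L], a tableau
    of a bicrucial word has exactly [L] rows and [K] columns, so [T'] is not a
    rectangle; it has a second corner and strictly more words than [T]
    ([grow_not_onto]). This uses that a bicrucial word of length [n] exists, which
    holds from length [K + 2 * L - 2] on ([exists_bicrucial_word]). If
    [n + 1 = K * L], every avoiding word of length [n + 1] is bicrucial, whereas
    some avoiding word of length [n] is not ([stuck_word_not_bicrucial]), and its
    image is missed by the bicrucial words. *)

Set Implicit Arguments.
Unset Strict Implicit.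
Unset Printing Implicit Defensive.

(** * Monotone subsequences and Knuth moves *)

Definition chain (R : rel nat) (m : nat) (w : seq nat) : Prop :=
  exists s, [/\ subseq s w, sorted R s & size s = m].

Definition bounded (R : rel nat) (m : nat) (w : seq nat) : Prop :=
  forall s, subseq s w -> sorted R s -> size s <= m.

Lemma gtn_trans : transitive gtn.
Proof. by move=> x y z /= xy yz; apply: ltn_trans xy. Qed.

Lemma gtnn : irreflexive gtn. Proof. exact: ltnn. Qed.

Lemma subseq_catP (s a b : seq nat) : subseq s (a ++ b) ->
  exists s1 s2, [/\ s = s1 ++ s2, subseq s1 a & subseq s2 b].
Proof.
case/subseqP=> m sz ->; exists (mask (take (size a) m) a), (mask (drop (size a) m) b).
split; [|exact: mask_subseq|exact: mask_subseq].
by rewrite -mask_cat ?cat_take_drop // size_takel // sz size_cat leq_addr.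
Qed.

Lemma sorted_catP (R : rel nat) s1 s2 : transitive R ->
  sorted R (s1 ++ s2) = [&& allrel R s1 s2, sorted R s1 & sorted R s2].
Proof. by move=> Rt; rewrite !sorted_pairwise // pairwise_cat. Qed.

Lemma chain_leq R m m' w : m' <= m -> chain R m w -> chain R m' w.
Proof.
move=> le [s [sw ss sz]]; exists (take m' s); split.
- exact: subseq_trans (take_subseq _ _) sw.
- exact: take_sorted.
- by rewrite size_takel ?sz.
Qed.

Lemma chain_sub R m w w' : subseq w w' -> chain R m w -> chain R m w'.
Proof. by move=> ww [s [sw ss sz]]; exists s; split=> //; apply: subseq_trans ww. Qed.

Lemma boundedP R m w : bounded R m w <-> ~ chain R m.+1 w.
Proof.
split=> [b [s [sw ss sz]]|nc s sw ss]; first by have := b s sw ss; lia.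
rewrite leqNgt; apply/negP=> lt; apply: nc; apply: (chain_leq lt).
by exists s.
Qed.

Lemma bounded_chain R m m' w : bounded R m w -> chain R m' w -> m' <= m.
Proof. by move=> b [s [sw ss <-]]; apply: b. Qed.

Lemma bounded_leq R m m' w : m <= m' -> bounded R m w -> bounded R m' w.
Proof. by move=> le b s sw ss; apply: leq_trans (b s sw ss) le. Qed.

Lemma bounded_cat (R : rel nat) m1 m2 u v : transitive R ->
  bounded R m1 u -> bounded R m2 v -> bounded R (m1 + m2) (u ++ v).
Proof.
move=> Rt b1 b2 s /subseq_catP[s1 [s2 [-> h1 h2]]].
rewrite sorted_catP // => /and3P[_ ss1 ss2].
by rewrite size_cat leq_add ?b1 ?b2.
Qed.

(** A chain with letters on both sides would have to cross from [u] to [v]. *)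
Lemma bounded_cat_max (R : rel nat) m u v : transitive R ->
  (forall x y, x \in u -> y \in v -> ~~ R x y) ->
  bounded R m u -> bounded R m v -> bounded R m (u ++ v).
Proof.
move=> Rt nR b1 b2 s /subseq_catP[s1 [s2 [-> h1 h2]]].
rewrite sorted_catP // => /and3P[al ss1 ss2].
case: s1 h1 al ss1 => [|x s1] h1 al ss1; first exact: b2.
case: s2 h2 al ss2 => [|y s2] h2 al ss2; first by rewrite cats0; apply: b1.
have := nR x y (mem_subseq h1 (mem_head _ _)) (mem_subseq h2 (mem_head _ _)).
by rewrite (allrelP al) ?mem_head.
Qed.

Lemma bounded_anti (R R' : rel nat) w : transitive R -> transitive R' ->
  (forall x y, R x y -> ~~ R' x y) -> sorted R w -> bounded R' 1 w.
Proof.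
move=> Rt Rt' ex sw [|x [|y s]] // sub.
have: sorted R [:: x, y & s] by apply: subseq_sorted sub sw.
by rewrite /= => /andP[/ex/negbTE-> _].
Qed.

Lemma chain_map (R : rel nat) (g : nat -> nat) m w :
  (forall x y, R (g x) (g y) = R x y) -> chain R m (map g w) <-> chain R m w.
Proof.
move=> mono; split=> [[s [/subseqP[b sz ->]]]|[s [sw ss sz]]].
  rewrite -map_mask => ss; rewrite size_map => <-.
  exists (mask b w); split; [exact: mask_subseq| |by []].
  by move: ss; rewrite sorted_map; rewrite (@eq_sorted _ _ R) // => x y; rewrite /= mono.
exists (map g s); split; [exact: map_subseq| |by rewrite size_map].
by rewrite sorted_map (@eq_sorted _ _ R) // => x y; rewrite /= mono.
Qed.

(** A factor [p] may be exchanged for [p'] as soon as every chain inside [p] has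
    a substitute inside [p'] of the same length that is compatible with at least
    the same letters before and after it. *)
Lemma chain_replace (R : rel nat) p p' : transitive R ->
  (forall s, subseq s p -> sorted R s ->
     exists s', [/\ subseq s' p', sorted R s', size s' = size s,
       forall c, all (R c) s -> all (R c) s' &
       forall c, all (R^~ c) s -> all (R^~ c) s']) ->
  forall a b m, chain R m (a ++ p ++ b) -> chain R m (a ++ p' ++ b).
Proof.
move=> Rt H a b m [s [/subseq_catP[s1 [s' [-> h1 /subseq_catP[s0 [s2 [-> h0 h2]]]]]]]].
rewrite !sorted_catP // => /and3P[al ss1 /and3P[al2 ss0 ss2]] <-.
have [t [tp st szt c1 c2]] := H s0 h0 ss0.
exists (s1 ++ t ++ s2); split.
- by rewrite !cat_subseq.
- rewrite !sorted_catP // ss1 st ss2 /= andbT; move: al.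
  rewrite !allrel_catr => /andP[a1 ->]; rewrite andbT; apply/andP; split.
    by apply/allP=> x xs; apply: c1; move/allP: a1; apply.
  rewrite allrelC; apply/allP=> x xs; apply: c2.
  by move: al2; rewrite allrelC => /allP; apply.
- by rewrite !size_cat szt.
Qed.

(** Of all chains, only those passing through [x; z] are lost in the move; there
    [y] can take over the role of [x], because it precedes [z] and lies between
    [x] and [z]. Stated for any strict order [R], it covers decreasing chains too:
    reversing the order exchanges [x] and [z] and keeps the shape of the move. *)
Lemma chain_knuth1 (R : rel nat) x y z a b m : transitive R -> irreflexive R ->
  R x y -> R y z ->
  chain R m (a ++ [:: y; z; x] ++ b) <-> chain R m (a ++ [:: y; x; z] ++ b).
Proof.
move=> Rt Ri xy yz; have xz := Rt _ _ _ xy yz.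
have nR u v : R u v -> R v u = false.
  by move=> uv; apply/negP=> /(Rt _ _ _ uv); rewrite Ri.
have swap b1 b2 b3 (p q : nat) : ~~ (b2 && b3) ->
  mask [:: b1; b2; b3] [:: y; p; q] = mask [:: b1; b3; b2] [:: y; q; p].
  by case: b1 b2 b3 => [] [] [].
split; apply: chain_replace => // s /subseqP[[|b1 [|b2 [|b3 []]]] // _ ->] ss.
all: have [/andP[e2 e3]|/swap e] := boolP (b2 && b3);
  last by rewrite e in ss *; move: ss; set t := mask _ _ => ss; exists t; split=> //;
    apply: mask_subseq.
  by rewrite {}e2 {}e3 in ss *; case: b1 ss => /=; rewrite (nR x z) ?andbF.
rewrite {}e2 {}e3 in ss *; case: b1 ss => /=; rewrite ?(nR x y) ?andbF // => _.
exists [:: y; z]; split; rewrite /= ?yz ?eqxx //.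
- by move=> c /and3P[cx cz _]; rewrite cz (Rt _ _ _ cx).
- by move=> c /and3P[cx cz _]; rewrite cz (Rt _ _ _ yz).
Qed.

(** The mirror image of [chain_knuth1]: in a chain through [x; z] the letter [y]
    takes over the role of [z]. *)
Lemma chain_knuth2 (R : rel nat) x y z a b m : transitive R -> irreflexive R ->
  R x y -> R y z ->
  chain R m (a ++ [:: x; z; y] ++ b) <-> chain R m (a ++ [:: z; x; y] ++ b).
Proof.
move=> Rt Ri xy yz; have xz := Rt _ _ _ xy yz.
have nR u v : R u v -> R v u = false.
  by move=> uv; apply/negP=> /(Rt _ _ _ uv); rewrite Ri.
have swap b1 b2 b3 (p q : nat) : ~~ (b1 && b2) ->
  mask [:: b1; b2; b3] [:: p; q; y] = mask [:: b2; b1; b3] [:: q; p; y].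
  by case: b1 b2 b3 => [] [] [].
split; apply: chain_replace => // s /subseqP[[|b1 [|b2 [|b3 []]]] // _ ->] ss.
all: have [/andP[e1 e2]|/swap e] := boolP (b1 && b2);
  last by rewrite e in ss *; move: ss; set t := mask _ _ => ss; exists t; split=> //;
    apply: mask_subseq.
  rewrite {}e1 {}e2 in ss *; case: b3 ss => /=; rewrite ?(nR y z) ?andbF // => _.
  exists [:: x; y]; split; rewrite ?[sorted _ _]/= ?xy //.
  + exact: (mask_subseq [:: false; true; true] [:: z; x; y]).
  + by move=> c /and3P[cx cz _]; rewrite /= cx (Rt _ _ _ cx).
  + by move=> c /and3P[cx cz _]; rewrite /= cx (Rt _ _ _ yz).
by rewrite {}e1 {}e2 in ss *; case: b3 ss => /=; rewrite (nR x z).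
Qed.

(** * Words with the same monotone subsequences in every context *)

(** Quantifying over all contexts [a], [b] makes this relation a congruence for
    concatenation by definition, so that it contains the plactic congruence as
    soon as it contains the two elementary Knuth moves. The multisets of letters
    are compared as well because a letter used to extend a word must be new. *)
Definition chain_equiv (w w' : seq nat) : Prop := perm_eq w w' /\
  forall a b m, (chain ltn m (a ++ w ++ b) <-> chain ltn m (a ++ w' ++ b)) /\
                (chain gtn m (a ++ w ++ b) <-> chain gtn m (a ++ w' ++ b)).

Lemma chain_equiv_refl w : chain_equiv w w. Proof. by split. Qed.

Lemma chain_equiv_sym w w' : chain_equiv w w' -> chain_equiv w' w.
Proof. by case=> p h; split=> [|a b m]; [rewrite perm_sym|case: (h a b m); split;
  symmetry]. Qed.

Lemma chain_equiv_trans w1 w2 w3 : chain_equiv w1 w2 -> chain_equiv w2 w3 ->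
  chain_equiv w1 w3.
Proof.
move=> [p1 h1] [p2 h2]; split=> [|a b m]; first exact: perm_trans p1 p2.
have [i1 d1] := h1 a b m; have [i2 d2] := h2 a b m.
by split; [rewrite i1|rewrite d1].
Qed.

Lemma chain_equiv_cat c d w w' : chain_equiv w w' ->
  chain_equiv (c ++ w ++ d) (c ++ w' ++ d).
Proof.
move=> [p h]; split=> [|a b m]; first by rewrite perm_cat2l perm_cat2r.
by have := h (a ++ c) (d ++ b) m; rewrite -!catA.
Qed.

Lemma chain_equiv_cons x w w' : chain_equiv w w' -> chain_equiv (x :: w) (x :: w').
Proof. by move/(chain_equiv_cat [:: x] [::]); rewrite !cats0. Qed.

Lemma chain_equiv_rcons x w w' : chain_equiv w w' -> chain_equiv (rcons w x) (rcons w' x).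
Proof. by move/(chain_equiv_cat [::] [:: x]); rewrite !cats1. Qed.

Lemma chain_equiv_chain w w' m : chain_equiv w w' ->
  (chain ltn m w <-> chain ltn m w') /\ (chain gtn m w <-> chain gtn m w').
Proof. by case=> _ /(_ [::] [::] m); rewrite !cats0. Qed.

Lemma chain_equiv_knuth1 x y z : x < y < z -> chain_equiv [:: y; z; x] [:: y; x; z].
Proof.
case/andP=> xy yz; split=> [|a b m]; first by rewrite perm_cons (perm_catC [:: z] [:: x]).
split; first exact: (chain_knuth1 _ _ _ ltn_trans ltnn xy yz).
by symmetry; apply: (chain_knuth1 _ _ _ gtn_trans gtnn yz xy).
Qed.

Lemma chain_equiv_knuth2 x y z : x < y < z -> chain_equiv [:: x; z; y] [:: z; x; y].
Proof.
case/andP=> xy yz; split=> [|a b m]; first by rewrite (perm_catCA [:: x] [:: z]).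
split; first exact: (chain_knuth2 _ _ _ ltn_trans ltnn xy yz).
by symmetry; apply: (chain_knuth2 _ _ _ gtn_trans gtnn yz xy).
Qed.

(** The letter [x] travels to the left through the letters greater than [y], by
    moves of the first kind. *)
Lemma chain_equiv_row_right x y v : sorted ltn [:: x, y & v] ->
  chain_equiv (y :: rcons v x) [:: y, x & v].
Proof.
elim/last_ind: v => [_|v z IH]; first exact: chain_equiv_refl.
rewrite /sorted -rcons_cons rcons_path => /andP[srt vz].
apply: chain_equiv_trans (_ : chain_equiv (y :: rcons (rcons v x) z) _); last first.
  by apply: (@chain_equiv_rcons z (y :: rcons v x) [:: y, x & v]); apply: IH.
have xl : x < last y v.
  by apply: (allP (order_path_min ltn_trans srt)); apply: mem_last.
have xz : x < last y v < z by rewrite xl.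
rewrite -!rcons_cons !lastI -!cats1 -!catA.
by have := chain_equiv_cat (belast y v) [::] (chain_equiv_knuth1 xz).
Qed.

(** The bumped letter [y] travels to the left through the letters smaller than
    [x], by moves of the second kind. *)
Lemma chain_equiv_row_left u x y : sorted ltn (u ++ [:: x; y]) ->
  chain_equiv (u ++ [:: y; x]) (y :: rcons u x).
Proof.
elim/last_ind: u x y => [|u p IH] x y srt; first exact: chain_equiv_refl.
have [pxy sp] : p < x < y /\ sorted ltn (u ++ [:: p; y]).
  move: srt; rewrite cat_rcons !(sorted_catP _ _ ltn_trans) /=.
  rewrite !allrel_consr => /and3P[/and3P[-> _ ->] -> /and3P[px xy _]].
  by rewrite px xy /= (ltn_trans px xy) /=; split => //; exact: allrel0r.
rewrite cat_rcons.
apply: chain_equiv_trans (_ : chain_equiv (u ++ [:: y; p; x]) _).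
  by have := chain_equiv_cat u [::] (chain_equiv_knuth2 pxy).
by have := chain_equiv_rcons x (IH _ _ sp); rewrite -!cats1 -!catA /= -!catA.
Qed.

(** Row insertion of [x], which bumps [y], seen as a sequence of Knuth moves. *)
Lemma chain_equiv_row u x y v : sorted ltn (u ++ [:: x, y & v]) ->
  chain_equiv (rcons (u ++ y :: v) x) (y :: u ++ x :: v).
Proof.
move=> srt; have [srt1 srt2] : sorted ltn [:: x, y & v] /\ sorted ltn (u ++ [:: x; y]).
  split; first by move: srt; rewrite (sorted_catP _ _ ltn_trans) => /and3P[].
  apply: subseq_sorted srt; first exact: ltn_trans.
  by apply: cat_subseq => //; exact: (prefix_subseq [:: x; y]).
apply: chain_equiv_trans (_ : chain_equiv (u ++ [:: y, x & v]) _).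
  rewrite rcons_cat; have := chain_equiv_cat u [::] (chain_equiv_row_right srt1).
  by rewrite !cats0.
have := chain_equiv_cat [::] v (chain_equiv_row_left srt2).
by rewrite /= -catA cat_rcons.
Qed.

(** * Tableaux and row insertion *)

(** Rows are listed from the top one, and read from the bottom one. *)
Fixpoint reading (T : seq (seq nat)) : seq nat :=
  if T is r :: T' then reading T' ++ r else [::].

(** As a total function of the row index, so that two tableaux have the same
    shape when these functions agree pointwise. *)
Definition row_len (T : seq (seq nat)) (i : nat) : nat := size (nth [::] T i).

Definition below (r s : seq nat) : Prop :=
  size s <= size r /\ forall i, i < size s -> nth 0 r i < nth 0 s i.

Fixpoint tableau (T : seq (seq nat)) : Prop :=
  if T is r :: T' then
    [/\ r != [::], sorted ltn r, below r (head [::] T') & tableau T']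
  else True.

Definition lower (x : nat) (r : seq nat) := [seq a <- r | a < x].
Definition upper (x : nat) (r : seq nat) := [seq a <- r | x < a].

Fixpoint insert (x : nat) (T : seq (seq nat)) : seq (seq nat) :=
  if T is r :: T' then
    if upper x r is y :: v then (lower x r ++ x :: v) :: insert y T' else rcons r x :: T'
  else [:: [:: x]].

(** Reverse row insertion from the corner ending row [j]: the letter removed
    there replaces, in each row above, the greatest smaller letter. A last row
    that becomes empty disappears. *)
Fixpoint uninsert (j : nat) (T : seq (seq nat)) : seq (seq nat) * nat :=
  if T is r :: T' then
    if j is j'.+1 then
      let: (T0, y) := uninsert j' T' in
      ((take (size (lower y r)).-1 (lower y r) ++ y :: upper y r) :: T0,
       last 0 (lower y r))
    else (if size r == 1 then T' else take (size r).-1 r :: T', last 0 r)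
  else ([::], 0).

(** [step x T j T'] holds when inserting [x] into [T] gives [T'] and the new cell
    is at the end of row [j]. Read from left to right it describes [insert], and
    read from right to left it describes [uninsert], so that properties common to
    both follow from one induction on this relation. *)
Inductive step : nat -> seq (seq nat) -> nat -> seq (seq nat) -> Prop :=
| StepNew x : step x [::] 0 [:: [:: x]]
| StepEnd x r T : r != [::] -> all (ltn^~ x) r -> step x (r :: T) 0 (rcons r x :: T)
| StepBump x y u v T j T' : sorted ltn (u ++ [:: x, y & v]) -> step y T j T' ->
    step x ((u ++ y :: v) :: T) j.+1 ((u ++ x :: v) :: T').

Lemma filter0 (a : pred nat) s : all (predC a) s -> filter a s = [::].
Proof. by elim: s => //= b s IH /andP[/negbTE-> /IH]. Qed.

Lemma lower_upperE u x v : all (ltn^~ x) u -> all (ltn x) v ->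
  (lower x (u ++ v) = u) * (upper x (u ++ v) = v).
Proof.
move=> h1 h2; rewrite /lower /upper !filter_cat (all_filterP h1) (all_filterP h2).
rewrite !filter0 ?cats0 //.
  by apply: sub_all h1 => a /= ax; rewrite -leqNgt ltnW.
by apply: sub_all h2 => a /= ax; rewrite -leqNgt ltnW.
Qed.

Lemma sorted_pivot u x v : sorted ltn (u ++ x :: v) ->
  all (ltn^~ x) u /\ all (ltn x) v.
Proof.
rewrite (sorted_catP _ _ ltn_trans) allrel_consr => /and3P[/andP[-> _] _].
by move/(order_path_min ltn_trans).
Qed.

Lemma lower_upper x r : sorted ltn r -> x \notin r -> r = lower x r ++ upper x r.
Proof.
elim: r => //= a r IH /[dup] /path_sorted /IH {}IH.
rewrite inE negb_or => /(order_path_min ltn_trans) h /andP[xa /IH e].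
case: (ltngtP a x) xa => // ax _ /=; first by rewrite {1}e.
have h' : all (ltn x) r by apply: sub_all h => b /= ab; apply: ltn_trans ab.
by have [-> ->] := @lower_upperE [::] x r isT h'.
Qed.

Lemma step_insert x T j T' : step x T j T' -> insert x T = T'.
Proof.
elim=> {x T j T'} //= [x r T _ al|x y u v T j T' srt _ IH].
  by have := @lower_upperE r x [::] al isT; rewrite cats0 => -[_ ->].
have [a1 a2] := sorted_pivot srt.
by have [-> ->] := lower_upperE a1 a2; rewrite IH.
Qed.

Lemma step_uninsert x T j T' : step x T j T' -> uninsert j T' = (T, x).
Proof.
elim=> {x T j T'} //= [x r T r0 al|x y u v T j T' srt _ ->].
  rewrite size_rcons last_rcons /= -cats1 take_size_cat // eqSS size_eq0.
  by rewrite (negbTE r0).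
have [|a1 a2] := @sorted_pivot (rcons u x) y v; first by rewrite cat_rcons.
have := lower_upperE a1 a2; rewrite cat_rcons => -[-> ->].
by rewrite size_rcons last_rcons -cats1 take_size_cat.
Qed.

Lemma step_row_len x T j T' i : step x T j T' -> row_len T' i = row_len T i + (i == j).
Proof.
move=> st; elim: st i => {x T j T'} [x|x r T _ _|x y u v T j T' _ _ IH] [|i].
all: rewrite /row_len /= ?nth_nil ?size_rcons ?size_cat /= ?addn0 ?addn1 //.
exact: IH.
Qed.

Lemma step_chain_equiv x T j T' : step x T j T' ->
  chain_equiv (reading T') (rcons (reading T) x).
Proof.
elim=> {x T j T'} //= [x r T _ _|x y u v T j T' srt _ IH].
  by rewrite -rcons_cat; apply: chain_equiv_refl.
apply: chain_equiv_trans (_ : chain_equiv (rcons (reading T) y ++ u ++ x :: v) _).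
  by have := chain_equiv_cat [::] (u ++ x :: v) IH.
rewrite rcons_cat cat_rcons; apply: chain_equiv_sym.
by have := chain_equiv_cat (reading T) [::] (chain_equiv_row srt); rewrite !cats0.
Qed.

Lemma step_perm x T j T' : step x T j T' -> perm_eq (reading T') (x :: reading T).
Proof. by move/step_chain_equiv=> [+ _]; rewrite perm_sym perm_rcons perm_sym. Qed.

(** * Insertion and its inverse preserve tableaux *)

(** One row [r] and the next row [s] when the letter [y] bumped from place [p] of
    [r] lands at place [q] of [s]. In both directions the heart of the matter is
    that bumped letters drift to the left, [q <= p]. *)
Lemma below_bump r s p q x y : p < size r -> nth 0 r p = y -> x < y ->
  (forall i, i < p -> nth 0 r i < x) ->
  (forall i, p < i < size r -> y < nth 0 r i) ->
  q <= size s -> (forall i, i < q -> nth 0 s i < y) ->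
  (forall i, q <= i < size s -> y < nth 0 s i) ->
  below r s <-> below (set_nth 0 r p x) (set_nth 0 s q y).
Proof.
move=> pr rp xy rlt rgt qs slt sgt.
rewrite /below !size_set_nth (maxn_idPr pr); split=> -[sz h].
  have qp : q <= p.
    rewrite leqNgt; apply/negP=> pq; have := slt _ pq; have := h p; lia.
  split=> [|i ilt]; first by lia.
  rewrite !nth_set_nth /=; case: (i =P q) => [->|iq].
    by case: (q =P p) => // nqp; have := rlt q; lia.
  by have := h i; case: (i =P p) => [e|_]; [subst i|]; lia.
have qp : q <= p.
  rewrite leqNgt; apply/negP=> pq; have := h q.
  rewrite !nth_set_nth /= eqxx; have := rgt q.
  by case: (q =P p); lia.
split=> [|i ilt]; first by lia.
have := h i; rewrite !nth_set_nth /=; have := sgt i; have := rlt i.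
by case: (i =P q) => ?; case: (i =P p) => ?; subst=> //; lia.
Qed.

Lemma set_nth_cat (u v : seq nat) x y : set_nth 0 (u ++ y :: v) (size u) x = u ++ x :: v.
Proof. by elim: u => //= a u ->. Qed.

Lemma pivot_nth u y v : sorted ltn (u ++ y :: v) ->
  (forall i, i < size u -> nth 0 (u ++ y :: v) i < y) /\
  (forall i, size u < i < size (u ++ y :: v) -> y < nth 0 (u ++ y :: v) i).
Proof.
case/sorted_pivot=> /allP h1 /allP h2; split=> i ilt.
  by rewrite nth_cat ilt; apply: h1; rewrite mem_nth.
rewrite size_cat /= in ilt; rewrite nth_cat (_ : i < size u = false); last by lia.
have -> : i - size u = (i - size u).-1.+1 by lia.
by rewrite /=; apply: h2; apply: mem_nth; move: ilt; move: (size v); lia.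
Qed.

(** What a step does to the top row: the incoming letter is written at the place
    [q] that separates smaller from greater letters; [q] is the length of the row
    when the letter is appended. *)
Lemma step_head y T j T' : step y T j T' -> let s := head [::] T in
  exists q, [/\ q <= size s, head [::] T' = set_nth 0 s q y,
    forall i, i < q -> nth 0 s i < y & forall i, q <= i < size s -> y < nth 0 s i].
Proof.
case=> {y T j T'} /= [y|y r T r0 /allP al|y z u v T j T' srt _].
- by exists 0; split=> //=; case.
- exists (size r); split=> //; last by move=> i; lia.
    by elim: r {r0 al} => //= a r <-.
  by move=> i ir; apply: al; apply: mem_nth.
exists (size u); split; first by rewrite size_cat leq_addr.
- by rewrite set_nth_cat.
- move=> i iu; have [] := pivot_nth srt.
  by move/(_ i iu); rewrite !nth_cat iu.
move=> i /andP[ui ilt]; rewrite nth_cat (_ : i < size u = false);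
  last by rewrite ltnNge ui.
have [_ /allP] := sorted_pivot srt; apply; apply: mem_nth.
by rewrite ltn_subLR // -size_cat.
Qed.

Lemma step_below x y u v T j T' : sorted ltn (u ++ [:: x, y & v]) ->
  step y T j T' ->
  below (u ++ y :: v) (head [::] T) <-> below (u ++ x :: v) (head [::] T').
Proof.
move=> srt st; have [xlt /= /andP[xy _]] := sorted_pivot srt.
have [q [qs -> h1 h2]] := step_head st.
rewrite -(set_nth_cat u v x y); apply: below_bump => //.
- by rewrite size_cat -[X in X < _]addn0 ltn_add2l.
- by rewrite nth_cat ltnn subnn.
- by move=> i iu; rewrite nth_cat iu; apply: (allP xlt); apply: mem_nth.
have /pivot_nth[//] : sorted ltn (u ++ y :: v).
apply: subseq_sorted srt; first exact: ltn_trans.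
by apply: cat_subseq => //; apply: (suffix_subseq [:: x]).
Qed.

Lemma below_rcons r s x : below r s -> below (rcons r x) s.
Proof.
case=> sz h; split=> [|i is_]; first by rewrite size_rcons leqW.
by rewrite nth_rcons (leq_trans is_ sz) h.
Qed.

Lemma below_belast r s x : size s <= size r -> below (rcons r x) s -> below r s.
Proof.
move=> sz [_ h]; split=> // i is_.
by have := h i is_; rewrite nth_rcons (leq_trans is_ sz).
Qed.

Lemma sorted_drop_mid u x y v : sorted ltn (u ++ [:: x, y & v]) ->
  sorted ltn (u ++ x :: v) /\ sorted ltn (u ++ y :: v).
Proof.
move=> srt; split; apply: subseq_sorted srt; try exact: ltn_trans.
  by apply: cat_subseq => //; apply: (@cat_subseq _ [:: x] v [:: x]) => //;
    apply: (suffix_subseq [:: y]).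
by apply: cat_subseq => //; apply: (suffix_subseq [:: x]).
Qed.

Lemma sorted_rconsE r x : sorted ltn (rcons r x) = all (ltn^~ x) r && sorted ltn r.
Proof. by rewrite -cats1 (sorted_catP _ _ ltn_trans) allrel1r andbT. Qed.

Lemma step_tableau x T j T' : step x T j T' -> tableau T -> tableau T'.
Proof.
elim=> {x T j T'} [x _|x r T r0 al [_ srt bel tT]
  |x y u v T j T' srt st IH [_ _ bel tT]] /=.
- by split.
- by rewrite sorted_rconsE al srt; split=> //; [case: (r)|apply: below_rcons].
split; [by case: (u)|exact: (sorted_drop_mid srt).1| |exact: IH].
exact/(step_below srt st).
Qed.

Lemma step_tableau_inv x T j T' : step x T j T' -> tableau T' ->
  row_len T' j.+1 < row_len T' j -> tableau T.
Proof.
elim=> {x T j T'} //= [x r T r0 al [_]|x y u v T j T' srt st IH [_ _ bel tT] cj].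
  rewrite sorted_rconsE => /andP[_ srt] bel tT;
    rewrite /row_len /= nth0 size_rcons ltnS => sz.
  by split=> //; apply: below_belast bel.
split; [by case: (u)|exact: (sorted_drop_mid srt).2| |exact: IH].
exact/(step_below srt st).
Qed.

Lemma row_len_gt0 T : tableau T -> forall i, (0 < row_len T i) = (i < size T).
Proof.
elim: T => [|r T IH] /=; first by move=> _ i; rewrite /row_len nth_nil.
by case=> r0 _ _ tT [|i]; [rewrite /row_len /= lt0n size_eq0 r0|exact: IH].
Qed.

Lemma below_head r s : below r s -> s != [::] -> head 0 r < head 0 s.
Proof. by case: s => // a s [] /= _ /(_ 0 isT); case: r. Qed.

(** This is what guarantees that a letter coming up from below finds a smaller
    letter to replace. *)
Lemma tableau_head_lt r T : tableau (r :: T) -> forall a, a \in reading T -> head 0 r < a.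
Proof.
elim: T r => [|s T IH] r //= [r0 _ bel tT] a.
have /= [s0 srt _ _] := tT.
have rs := below_head bel s0.
rewrite mem_cat => /orP[/(IH _ tT)|]; first exact: ltn_trans.
case: s srt rs {IH bel tT s0} => //= b s /(order_path_min ltn_trans) /allP h rb.
by rewrite inE => /predU1P[->//|/h]; apply: ltn_trans.
Qed.

Lemma insert_step T x : tableau T -> uniq (x :: reading T) ->
  exists j, step x T j (insert x T).
Proof.
elim: T x => [|r T IH] x /=; first by exists 0; constructor.
case=> r0 srt _ tT; rewrite mem_cat negb_or cat_uniq.
case/and3P=> /andP[xT xr] uT /andP[/hasPn dis ur].
have [al ah] : all (ltn^~ x) (lower x r) /\ all (ltn x) (upper x r) by split;
  apply: filter_all.
have er := lower_upper srt xr; case eh: (upper x r) er ah => [|y v] er ah.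
  by exists 0; constructor=> //; rewrite er cats0.
have [j st] : exists j, step y T j (insert y T).
  by apply: IH; rewrite //= uT andbT; apply: dis; rewrite er mem_cat mem_head orbT.
exists j.+1; rewrite {1}er; constructor=> //; move: srt; rewrite {1}er.
rewrite !(sorted_catP _ _ ltn_trans) => /and3P[ull -> sv] /=.
move: ah sv => /= /andP[-> _] ->; rewrite !andbT allrel_consr ull andbT.
exact: al.
Qed.

Lemma uninsert_step T j : tableau T -> uniq (reading T) -> row_len T j.+1 < row_len T j ->
  step (uninsert j T).2 (uninsert j T).1 j T.
Proof.
elim: T j => [|r T IH] j /=; first by rewrite /row_len !nth_nil.
case=> r0 srt bel tT; rewrite cat_uniq => /and3P[uT /hasPn dis ur].
case: j => [|j] cj /=.
  case: (lastP r) r0 srt cj => // {r dis ur bel} r x _.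
  rewrite last_rcons sorted_rconsE size_rcons eqSS size_eq0 /row_len /= nth0 =>
    /andP[al srt].
  case: (r =P [::]) => [->|/eqP r0] /=.
    rewrite ltnS leqn0 size_eq0 => /eqP;
      case: T tT {uT IH} => [_ _|s T [/negP s0 _ _ _ /eqP//]].
    exact: StepNew.
  by move=> _; rewrite -cats1 take_size_cat // cats1; constructor.
have {IH} := IH j tT uT cj.
case: (uninsert j T) => T0 y /= st.
have yT : y \in reading T by rewrite (perm_mem (step_perm st)) mem_head.
have yr : y \notin r by apply/negP=> /dis; rewrite /= yT.
have [al ah] : all (ltn^~ y) (lower y r) /\ all (ltn y) (upper y r) by split;
  apply: filter_all.
have er := lower_upper srt yr.
have: lower y r != [::].
  have hy : head 0 r < y by apply: (@tableau_head_lt r T).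
  rewrite -has_filter; apply/hasP; exists (head 0 r) => //.
  by case: (r) r0 => // a s _; apply: mem_head.
case: (lastP (lower y r)) al er => // u x al er _.
rewrite last_rcons size_rcons -cats1 take_size_cat //.
have e : r = u ++ x :: upper y r by rewrite {1}er cat_rcons.
rewrite {2}e; constructor=> //; move: srt; rewrite {1}e.
rewrite !(sorted_catP _ _ ltn_trans) => /and3P[].
rewrite !allrel_consr => /andP[ux uv] -> /=.
move: al; rewrite all_rcons => /andP[xy uy] pv.
rewrite /= in xy; rewrite ux uv xy /= andbT; apply/andP; split; first exact: uy.
by case: (upper y r) ah pv => //= a v /andP[-> _] /andP[].
Qed.

(** * Monotone subsequences of reading words *)

(** Columns increase downwards, so a row has at least as many small letters as
    the row below it. *)
Lemma below_count r s b : below r s -> count (leq^~ b) s <= count (leq^~ b) r.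
Proof.
elim: s r => [|a s IH] [|a' r] [] //= sz h; apply: leq_add.
  by have /= := h 0 isT; case: leqP => //; case: (leqP a' b) => //; lia.
by apply: IH; split=> // i; apply: (h i.+1).
Qed.

(** An increasing subsequence of the reading word moves upwards through the rows.
    The bound is stable under this motion: the part taken in lower rows is
    transported to the top row by [below_count], and the letters taken in the top
    row are greater than those counted so far. *)
Lemma reading_incr_count T s : tableau T -> subseq s (reading T) -> sorted ltn s ->
  size s <= count (leq^~ (last 0 s)) (head [::] T).
Proof.
elim: T s => [|r T IH] s; first by move=> _; rewrite subseq0 => /eqP->.
rewrite /= => -[r0 srt bel tT] /subseq_catP[s1 [s2 [-> h1 h2]]].
rewrite (sorted_catP _ _ ltn_trans) => /and3P[al ss1 ss2].
have {IH} := leq_trans (IH _ tT h1 ss1) (below_count _ bel).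
case: (lastP s2) ss2 al h2 => [|{}s2 c] ss2 al h2; first by rewrite cats0.
rewrite last_cat last_rcons size_cat.
have s2c : all (leq^~ c) (rcons s2 c).
  move: ss2; rewrite sorted_rconsE all_rcons leqnn => /andP[h _] /=.
  by apply: sub_all h => a /= /ltnW.
case: (lastP s1) al => [_ _|{h1 ss1}s1 d al le].
  by move: s2c; rewrite all_count => /eqP<-; apply: leq_count_subseq.
rewrite last_rcons in le.
have dc : d <= c by apply: ltnW; apply: (allrelP al); rewrite mem_rcons mem_head.
have s2d : all (fun a => d < a <= c) (rcons s2 c).
  apply/allP=> a ac; rewrite (allP s2c _ ac) andbT.
  by apply: (allrelP al) => //; rewrite mem_rcons mem_head.
apply: leq_trans (leq_add le (_ : _ <= count (fun a => d < a <= c) r)) _.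
  by move: s2d; rewrite all_count => /eqP<-; apply: leq_count_subseq.
rewrite -count_predUI -[X in _ <= X]addn0; apply: leq_add.
  by apply: sub_count => a /=; lia.
by rewrite leqNgt -has_count; apply/hasPn=> a _ /=; lia.
Qed.

Lemma reading_incr_bounded T : tableau T -> bounded ltn (size (head [::] T)) (reading T).
Proof.
by move=> tT s sT ss; apply: leq_trans (reading_incr_count tT sT ss) (count_size _ _).
Qed.

(** Each row contributes at most one letter to a decreasing subsequence. *)
Lemma reading_decr_bounded T : tableau T -> bounded gtn (size T) (reading T).
Proof.
elim: T => [|r T IH] /=; first by move=> _ s; rewrite subseq0 => /eqP->.
case=> _ srt _ tT; rewrite -addn1; apply: bounded_cat gtn_trans (IH tT) _.
apply: bounded_anti ltn_trans gtn_trans _ srt => x y /= xy.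
by rewrite -leqNgt ltnW.
Qed.

Lemma reading_incr_chain T : tableau T -> chain ltn (size (head [::] T)) (reading T).
Proof.
case: T => [|r T] /=; first by exists [::].
by case=> _ srt _ _; exists r; split=> //; apply: suffix_subseq.
Qed.

(** The first column, from bottom to top. *)
Lemma reading_decr_chain T : tableau T -> chain gtn (size T) (reading T).
Proof.
elim: T => [|r T IH] tT; first by exists [::].
have [r0 _ _ /IH[s [sT ss sz]]] := tT.
exists (rcons s (head 0 r)); split; last by rewrite size_rcons sz.
  by rewrite -cats1 cat_subseq //; case: (r) r0 => //= a r' _; rewrite eqxx sub0seq.
rewrite -cats1 (sorted_catP _ _ gtn_trans) ss !andbT; apply/allrelP=> a b aS.
rewrite inE => /eqP->; apply: (tableau_head_lt tT); exact: mem_subseq sT _ aS.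
Qed.

Lemma size_reading T : tableau T -> size (reading T) <= size T * size (head [::] T).
Proof.
elim: T => //= r T IH [_ _ [bel _] /IH {}IH]; rewrite size_cat mulSn addnC leq_add2l.
by apply: leq_trans IH _; rewrite leq_mul2l bel orbT.
Qed.

(** * The Robinson-Schensted tableau of a word *)

Definition RS (w : seq nat) : seq (seq nat) := foldl (fun T x => insert x T) [::] w.

Lemma RS_rcons w x : RS (rcons w x) = insert x (RS w).
Proof. by rewrite /RS foldl_rcons. Qed.

Lemma RS_chain_equiv w : uniq w -> tableau (RS w) /\ chain_equiv (reading (RS w)) w.
Proof.
elim/last_ind: w => [_|w x IH]; first by split=> //; apply: chain_equiv_refl.
rewrite rcons_uniq RS_rcons => /andP[xw uw]; have [tT eq] := IH uw.
have [|j st] := @insert_step (RS w) x tT.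
  by rewrite /= (perm_mem eq.1) xw (perm_uniq eq.1).
split; first exact: step_tableau st tT.
exact: chain_equiv_trans (step_chain_equiv st) (chain_equiv_rcons x eq).
Qed.

(** A tableau with more than [K * L] cells has more than [K] columns or more than
    [L] rows. *)
Lemma erdos_szekeres K L w : uniq w -> K * L < size w ->
  chain ltn K.+1 w \/ chain gtn L.+1 w.
Proof.
move=> uw lt; have [tT eq] := RS_chain_equiv uw.
have szT := size_reading tT; rewrite (perm_size eq.1) in szT.
case: (leqP (size (head [::] (RS w))) K) => hK.
  right; apply/(chain_equiv_chain _ eq).2; apply: chain_leq (reading_decr_chain tT).
  by rewrite ltnNge; apply/negP=> hL; have := leq_mul hL hK; lia.
left; apply/(chain_equiv_chain _ eq).1; exact: chain_leq hK (reading_incr_chain tT).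
Qed.

(** * Counting the words with a given tableau *)

Definition corners (n : nat) (T : seq (seq nat)) : seq nat :=
  [seq j <- iota 0 n | row_len T j.+1 < row_len T j].

(** The last letter of a word inserting to [T] ends up creating one of the corners
    of [T], and reverse insertion from this corner recovers the letter and the
    tableau of the rest of the word. The parameter [n] is the number of cells. *)
Fixpoint words (n : nat) (T : seq (seq nat)) : seq (seq nat) :=
  if n is n'.+1 then
    [seq rcons w (uninsert j T).2 | j <- corners n T, w <- words n' (uninsert j T).1]
  else [:: [::]].

Lemma size_rows T : tableau T -> size T <= size (reading T).
Proof.
elim: T => //= r T IH [r0 _ _ /IH le].
by rewrite size_cat -addn1 leq_add // lt0n size_eq0.
Qed.

Lemma row_len_lt T j : 0 < row_len T j -> j < size T.
Proof. by case: (ltnP j (size T)) => // le; rewrite /row_len nth_default. Qed.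

Lemma mem_corners T j : tableau T ->
  (j \in corners (size (reading T)) T) = (row_len T j.+1 < row_len T j).
Proof.
move=> tT; rewrite mem_filter mem_iota add0n /= andb_idr // => lt.
by apply: leq_trans (size_rows tT); apply: row_len_lt; apply: leq_trans lt.
Qed.

Lemma reading_size0 T : tableau T -> size (reading T) = 0 -> T = [::].
Proof. by move=> tT sz; have := size_rows tT; rewrite sz leqn0 size_eq0 => /eqP. Qed.

Lemma uninsert_tableau T j : tableau T -> uniq (reading T) ->
  row_len T j.+1 < row_len T j ->
  [/\ tableau (uninsert j T).1,
      perm_eq (reading T) ((uninsert j T).2 :: reading (uninsert j T).1)
    & size (reading (uninsert j T).1) = (size (reading T)).-1].
Proof.
move=> tT uT cj; have st := uninsert_step tT uT cj; have pm := step_perm st.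
by split=> //; [exact: step_tableau_inv st tT cj|rewrite (perm_size pm)].
Qed.

Lemma words_RS n T w : tableau T -> uniq (reading T) -> size (reading T) = n ->
  w \in words n T -> uniq w /\ RS w = T.
Proof.
elim: n T w => [|n IH] T w tT uT sz.
  by rewrite inE (reading_size0 tT sz) => /eqP->.
rewrite [words _ _]/= => /allpairsPdep[j [w0 [jc w0w ->]]].
rewrite -sz mem_corners // in jc; have st := uninsert_step tT uT jc.
have [tT0 pm sz0] := uninsert_tableau tT uT jc.
have := uT; rewrite (perm_uniq pm) /= => /andP[xT0 uT0].
rewrite sz in sz0; have [uw0 e] := IH _ w0 tT0 uT0 sz0 w0w.
rewrite RS_rcons e (step_insert st) rcons_uniq uw0 andbT; split=> //.
by rewrite -(perm_mem (RS_chain_equiv uw0).2.1) e.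
Qed.

Lemma row_len_noninc T i : tableau T -> row_len T i.+1 <= row_len T i.
Proof.
elim: T i => [|r T IH] i /=; first by rewrite /row_len !nth_nil.
by case=> _ _ [bel _] tT; case: i => [|i]; [rewrite /row_len /= nth0|apply: IH].
Qed.

Lemma RS_words w : uniq w -> w \in words (size w) (RS w).
Proof.
elim/last_ind: w => [//|w x IH]; rewrite rcons_uniq => /andP[xw uw].
have [tT eq] := RS_chain_equiv uw.
have uxT : uniq (x :: reading (RS w)) by rewrite /= (perm_mem eq.1) xw (perm_uniq eq.1).
have [j st] := insert_step tT uxT.
have un := step_uninsert st.
rewrite RS_rcons size_rcons [words _ _]/=.
apply/allpairsPdep; exists j, w; rewrite un; split=> //=; last exact: IH.
rewrite -(perm_size eq.1) -[_.+1]/(size (x :: reading (RS w))).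
rewrite -(perm_size (step_perm st)).
rewrite mem_corners; last exact: step_tableau st tT.
by rewrite !(step_row_len _ st) eqxx gtn_eqF // addn0 addn1 ltnS row_len_noninc.
Qed.

Lemma row_len_uninsert T j i : tableau T -> uniq (reading T) ->
  row_len T j.+1 < row_len T j ->
  row_len T i = row_len (uninsert j T).1 i + (i == j).
Proof. by move=> tT uT cj; apply: step_row_len (uninsert_step tT uT cj). Qed.

(** The number of words is computed from the shape alone: it is the number of
    standard tableaux of this shape, here through its recursion over corners. *)
Lemma words_size_row_len n T T' : tableau T -> tableau T' -> uniq (reading T) ->
  uniq (reading T') ->
  size (reading T) = n -> size (reading T') = n ->
  row_len T =1 row_len T' -> size (words n T) = size (words n T').
Proof.
elim: n T T' => [|n IH] T T' tT tT' uT uT' sz sz' eq //.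
rewrite [words _ T]/= [words _ T']/= !size_allpairs_dep.
have -> : corners n.+1 T' = corners n.+1 T by apply: eq_filter => j; rewrite !eq.
congr (sumn _); apply/eq_in_map=> j jc.
have cj : row_len T j.+1 < row_len T j by rewrite -mem_corners // sz.
have cj' : row_len T' j.+1 < row_len T' j by rewrite -!eq.
have [t0 p0 s0] := uninsert_tableau tT uT cj;
  have [t0' p0' s0'] := uninsert_tableau tT' uT' cj'.
have u0 : uniq (reading (uninsert j T).1) by move: uT; rewrite (perm_uniq p0) => /andP[].
have u0' : uniq (reading (uninsert j T').1) by move: uT';
  rewrite (perm_uniq p0') => /andP[].
apply: IH => //; [by rewrite s0 sz|by rewrite s0' sz'|] => i; apply/eqP.
by rewrite -(eqn_add2r (i == j)) -!row_len_uninsert // eq.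
Qed.

(** The shape of the tableau of the prefix reveals the corner that was used. *)
Lemma words_uniq n T : tableau T -> uniq (reading T) -> size (reading T) = n ->
  uniq (words n T).
Proof.
elim: n T => [//|n IH] T tT uT sz; rewrite [words _ _]/=.
have cP j : j \in corners n.+1 T ->
  [/\ row_len T j.+1 < row_len T j, tableau (uninsert j T).1,
    uniq (reading (uninsert j T).1) & size (reading (uninsert j T).1) = n].
  rewrite -sz mem_corners // => cj; have [t0 p0 ->] := uninsert_tableau tT uT cj.
  by split=> //; [move: uT; rewrite (perm_uniq p0) => /andP[]|rewrite sz].
apply: allpairs_uniq_dep => [|j /cP[cj t0 u0 s0]|].
- by rewrite filter_uniq ?iota_uniq.
- exact: IH.
move=> _ _ /allpairsPdep[j [w [/cP[cj t0 u0 s0] wj ->]]]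
  /allpairsPdep[i [v [/cP[ci t1 u1 s1] vi ->]]] /=.
move/rcons_inj=> [e _]; rewrite -{}e in vi *; congr (existT _ _ _).
have [_ e0] := words_RS t0 u0 s0 wj; have [_ e1] := words_RS t1 u1 s1 vi.
apply/eqP; have := row_len_uninsert j tT uT cj.
rewrite (row_len_uninsert j tT uT ci) -e0 e1 eqxx => /addnI.
by case: (j == i).
Qed.

Lemma words_nonempty n T : tableau T -> uniq (reading T) -> size (reading T) = n ->
  0 < size (words n T).
Proof.
elim: n T => [//|n IH] T tT uT sz; rewrite [words _ _]/=.
have sT : 0 < size T by case: (T) sz.
have cj : row_len T (size T).-1.+1 < row_len T (size T).-1.
  by rewrite prednK // {1}/row_len nth_default // row_len_gt0 // prednK.
have [t0 p0 s0] := uninsert_tableau tT uT cj; rewrite sz in s0.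
have u0 : uniq (reading (uninsert (size T).-1 T).1) by move: uT;
  rewrite (perm_uniq p0) => /andP[].
have := IH _ t0 u0 s0; case e: (words _ _) => [//|w ws] _.
rewrite -has_predT; apply/hasP; exists (rcons w (uninsert (size T).-1 T).2) => //.
apply/allpairsPdep; exists (size T).-1, w; rewrite e mem_head; split=> //.
by rewrite -sz mem_corners.
Qed.

Lemma words_sum n T : size (words n.+1 T) =
  \sum_(j <- corners n.+1 T) size (words n (uninsert j T).1).
Proof. by rewrite [words _ _]/= size_allpairs_dep sumnE big_map. Qed.

Lemma words_le n T j : tableau T -> uniq (reading T) -> size (reading T) = n.+1 ->
  row_len T j.+1 < row_len T j -> size (words n (uninsert j T).1) <= size (words n.+1 T).
Proof.
move=> tT uT sz cj; rewrite words_sum (bigD1_seq j) ?leq_addr //=.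
  by rewrite -sz mem_corners.
by rewrite filter_uniq ?iota_uniq.
Qed.

(** A second corner contributes words of its own, since any tableau is the
    tableau of some word. *)
Lemma words_lt n T i j : tableau T -> uniq (reading T) -> size (reading T) = n.+1 ->
  row_len T j.+1 < row_len T j -> row_len T i.+1 < row_len T i -> i != j ->
  size (words n (uninsert j T).1) < size (words n.+1 T).
Proof.
move=> tT uT sz cj ci ij; rewrite words_sum (bigD1_seq j) /=; first last.
- by rewrite filter_uniq ?iota_uniq.
- by rewrite -sz mem_corners.
rewrite -addn1 leq_add2l lt0n sum_nat_seq_neq0.
apply/hasP; exists i; first by rewrite -sz mem_corners.
have [t0 p0 s0] := uninsert_tableau tT uT ci; rewrite sz in s0.
rewrite ij -lt0n words_nonempty //.
by move: uT; rewrite (perm_uniq p0) => /andP[].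
Qed.

(** * Bicrucial words *)

Definition hits (K L : nat) (w : seq nat) : Prop :=
  chain ltn K.+1 w \/ chain gtn L.+1 w.

Definition avoids (K L : nat) (w : seq nat) : Prop :=
  bounded ltn K w /\ bounded gtn L w.

(** Here [K] and [L] are the greatest allowed lengths of an increasing and a
    decreasing subsequence. The extending letter ranges over all numbers that do
    not occur in the word, so that the property passes to longer words without
    renaming letters. *)
Definition bicrucial_word (K L : nat) (w : seq nat) : Prop :=
  avoids K L w /\ forall t, t \notin w -> hits K L (rcons w t) /\ hits K L (t :: w).

Lemma hits_sub K L w w' : subseq w w' -> hits K L w -> hits K L w'.
Proof. by move=> sub [h|h]; [left|right]; apply: chain_sub h. Qed.

Lemma hits_chain_equiv K L w w' : chain_equiv w w' -> hits K L w -> hits K L w'.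
Proof.
by move=> eq [h|h]; [left; apply/(chain_equiv_chain _ eq).1|right;
  apply/(chain_equiv_chain _ eq).2].
Qed.

Lemma avoids_chain_equiv K L w w' : chain_equiv w w' -> avoids K L w -> avoids K L w'.
Proof.
by move=> eq [/boundedP h1 /boundedP h2]; split; apply/boundedP;
  [move/(chain_equiv_chain _ eq).1|move/(chain_equiv_chain _ eq).2].
Qed.

Lemma bicrucial_word_chain_equiv K L w w' : chain_equiv w w' -> bicrucial_word K L w ->
  bicrucial_word K L w'.
Proof.
move=> eq [av ext]; split; first exact: avoids_chain_equiv av.
move=> t; rewrite -(perm_mem eq.1) => /ext[h1 h2].
split; first by apply: hits_chain_equiv h1; apply: chain_equiv_rcons.
by apply: hits_chain_equiv h2; apply: chain_equiv_cons.
Qed.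

(** The patterns created by an extension of the shorter word persist in the same
    extension of the longer word. *)
Lemma bicrucial_word_mono K L w w' : subseq w w' -> avoids K L w' ->
  bicrucial_word K L w -> bicrucial_word K L w'.
Proof.
move=> sub av [_ ext]; split=> // t tw'.
have [|h1 h2] := ext t; first by apply: contra tw'; apply: mem_subseq.
split; [apply: hits_sub h1|apply: hits_sub h2]; last by rewrite /= eqxx.
by rewrite -!cats1 cat_subseq.
Qed.

(** When all [K * L] places are taken, no word with one more letter avoids both
    patterns. *)
Lemma bicrucial_word_full K L w : uniq w -> size w = K * L -> avoids K L w ->
  bicrucial_word K L w.
Proof.
move=> uw sz av; split=> // t tw; split; apply: erdos_szekeres.
- by rewrite rcons_uniq tw.
- by rewrite size_rcons sz.
- by rewrite /= tw.
- by rewrite /= sz.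
Qed.

Lemma chain_belast (R : rel nat) m w t : transitive R ->
  chain R m.+1 (rcons w t) -> chain R m w.
Proof.
move=> Rt; rewrite -cats1 => -[s [/subseq_catP[s1 [s2 [-> h1 h2]]]]].
rewrite (sorted_catP _ _ Rt) => /and3P[_ ss1 _] sz.
apply: (@chain_leq _ (size s1)); last by exists s1.
by move: sz (size_subseq h2); rewrite size_cat /=; move: (size s1) (size s2); lia.
Qed.

(** The tableau fits in [L] rows and [K] columns exactly when the word avoids both
    patterns. *)
Lemma avoids_shape K L w : uniq w ->
  avoids K L w <-> size (head [::] (RS w)) <= K /\ size (RS w) <= L.
Proof.
move=> uw; have [tT eq] := RS_chain_equiv uw;
  split=> [/(avoids_chain_equiv (chain_equiv_sym eq))[b1 b2]|[h1 h2]].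
  split; first exact: bounded_chain b1 (reading_incr_chain tT).
  exact: bounded_chain b2 (reading_decr_chain tT).
apply: (avoids_chain_equiv eq); split.
  exact: bounded_leq h1 (reading_incr_bounded tT).
exact: bounded_leq h2 (reading_decr_bounded tT).
Qed.

(** * Adding a new maximum to a tableau *)

(** The new maximum goes to the end of the topmost row with fewer than [K] cells,
    or to a new row. The choice is canonical and the result stays within [K]
    columns. *)
Fixpoint add_max (K m : nat) (T : seq (seq nat)) : seq (seq nat) :=
  if T is r :: T' then
    if size r < K then rcons r m :: T' else r :: add_max K m T'
  else [:: [:: m]].

(** The length of [T] if every row is full: this is then the index of the new
    row. *)
Definition first_short (K : nat) (T : seq (seq nat)) : nat :=
  find (fun r : seq nat => size r < K) T.

Lemma add_max_row_len K m T i :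
  row_len (add_max K m T) i = row_len T i + (i == first_short K T).
Proof.
rewrite /row_len /first_short; elim: T i => [|r T IH] [|i] /=; rewrite ?nth_nil //.
all: case: ifP => _ /=; rewrite ?size_rcons ?addn0 ?addn1 ?IH ?eqSS //.
Qed.

Lemma add_max_perm K m T : perm_eq (reading (add_max K m T)) (m :: reading T).
Proof.
elim: T => //= r T IH; case: ifP => _ /=; first by rewrite -rcons_cat perm_rcons.
by apply: perm_trans (perm_cat IH (perm_refl r)) _.
Qed.

Lemma add_max_subseq K m T : subseq (reading T) (reading (add_max K m T)).
Proof.
elim: T => //= r T IH; case: ifP => _ /=; apply: cat_subseq => //.
exact: subseq_rcons.
Qed.

Lemma add_max_tableau K m T : tableau T -> all (ltn^~ m) (reading T) ->
  tableau (add_max K m T).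
Proof.
elim: T => [|r T IH] /=; first by [].
case=> r0 srt bel tT; rewrite all_cat => /andP[aT ar].
case: ifP => szr /=.
  by rewrite sorted_rconsE ar srt; split=> //; [case: (r)|apply: below_rcons].
split=> //; last exact: IH.
have rm i : i < size r -> nth 0 r i < m by move=> ir; apply: (allP ar); apply: mem_nth.
case: T {IH aT} tT bel => [|s T] tT bel /=.
  by case: r r0 rm {srt ar bel szr} => // a r _ rm; split=> // -[|//] _; apply: (rm 0).
case: ifP => // szs; case: bel => /= sz h; split=> [|i]; rewrite size_rcons; first by lia.
rewrite nth_rcons ltnS leq_eqVlt => /predU1P[->|ilt]; last by rewrite ilt h.
by rewrite ltnn eqxx rm //; lia.
Qed.

Lemma add_max_head K m T : 0 < K -> size (head [::] T) <= K ->
  size (head [::] (add_max K m T)) <= K.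
Proof. by case: T => //= r T _ h; case: ifP => //=; rewrite size_rcons. Qed.

Lemma size_add_max K m T : size (add_max K m T) = maxn (size T) (first_short K T).+1.
Proof.
rewrite /first_short; elim: T => //= r T IH; case: ifP => _ /=; first by lia.
by rewrite IH; lia.
Qed.

Lemma size_full K T : all (fun r : seq nat => K <= size r) T ->
  size T * K <= size (reading T).
Proof. by elim: T => //= r T IH /andP[Kr /IH le];
  rewrite size_cat mulSn addnC leq_add. Qed.

(** If no row were short, a tableau with [L] rows would have [K * L] cells. *)
Lemma first_short_lt K L T : size T <= L -> size (reading T) < K * L ->
  first_short K T < L.
Proof.
move=> le lt; rewrite /first_short; case: (boolP (has (fun r : seq nat => size r < K) T)).
  by rewrite has_find => /leq_trans; apply.
move=> nh; move: (nh); rewrite -all_predC => al.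
rewrite hasNfind // ltnNge; apply/negP=> le'.
have := @size_full K T;
  rewrite (eq_all (_ : _ =1 predC (fun r : seq nat => size r < K))); last first.
  by move=> r /=; rewrite -leqNgt.
move/(_ al); have -> : size T = L by lia.
by rewrite mulnC leqNgt lt.
Qed.

Lemma add_max_inj K m T1 T2 : tableau T1 -> tableau T2 -> m \notin reading T1 ->
  m \notin reading T2 ->
  add_max K m T1 = add_max K m T2 -> T1 = T2.
Proof.
(* deleting m, and the row it may leave empty, undoes add_max *)
pose del T := [seq r <- [seq [seq x <- r | x != m] | r <- T] | r != [::]].
suff delK T : tableau T -> m \notin reading T -> del (add_max K m T) = T.
  by move=> t1 t2 m1 m2 e; rewrite -(delK T1) // e delK.
have film r : m \notin r -> [seq x <- r | x != m] = r.
  by move=> mr; apply/all_filterP/allP=> x xr; apply: contraNneq mr => <-.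
have delT T' : tableau T' -> m \notin reading T' -> del T' = T'.
  elim: T' => //= r T' IH [r0 _ _ tT]; rewrite mem_cat negb_or => /andP[mT mr].
  by rewrite /del /= film // r0; congr (_ :: _); apply: IH.
rewrite /del; elim: T => [|r T IH] /=; first by rewrite eqxx.
case=> r0 _ _ tT; rewrite mem_cat negb_or => /andP[mT mr]; case: ifP => _ /=.
  by rewrite filter_rcons eqxx film // r0; congr (_ :: _); apply: delT.
by rewrite film // r0 IH.
Qed.

(** * The injection from length n to length n + 1 *)

(** The words of [add_max K m T] are at least as many as the words of [T], so the
    [i]-th word of the latter can be sent to the [i]-th word of the former. *)
Definition grow (K m : nat) (w : seq nat) : seq nat :=
  nth [::] (words (size w).+1 (add_max K m (RS w))) (index w (words (size w) (RS w))).

Lemma unique_cons_max m w : uniq w -> all (ltn^~ m) w -> uniq (m :: w).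
Proof.
move=> uw /allP lt; rewrite /= uw andbT; apply/negP=> /lt /=; by rewrite ltnn.
Qed.

Lemma RS_add_max K m w : uniq w -> all (ltn^~ m) w ->
  [/\ tableau (add_max K m (RS w)), perm_eq (reading (add_max K m (RS w))) (m :: w),
      uniq (reading (add_max K m (RS w))),
      size (reading (add_max K m (RS w))) = (size w).+1
    & row_len (add_max K m (RS w)) (first_short K (RS w)).+1 <
      row_len (add_max K m (RS w)) (first_short K (RS w))].
Proof.
move=> uw lt; have [tT eq] := RS_chain_equiv uw.
have pm : perm_eq (reading (add_max K m (RS w))) (m :: w).
  by apply: perm_trans (add_max_perm _ _ _) _; rewrite perm_cons eq.1.
split=> //; first by apply: add_max_tableau; rewrite // (perm_all _ eq.1).
- by rewrite (perm_uniq pm) unique_cons_max.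
- by rewrite (perm_size pm).
by rewrite !add_max_row_len eqxx gtn_eqF // addn0 addn1 ltnS row_len_noninc.
Qed.

(** Reverse insertion from the cell of the new maximum may alter the letters of
    the tableau, but it restores its shape. *)
Lemma words_uninsert_add_max K m w : uniq w -> all (ltn^~ m) w ->
  size (words (size w) (uninsert (first_short K (RS w)) (add_max K m (RS w))).1) =
  size (words (size w) (RS w)).
Proof.
move=> uw lt; have [tT eq] := RS_chain_equiv uw;
  have [tA pm uA sA cj] := RS_add_max K uw lt.
have [t0 p0 s0] := uninsert_tableau tA uA cj.
apply: words_size_row_len => //.
- by move: uA; rewrite (perm_uniq p0) => /andP[].
- by rewrite (perm_uniq eq.1).
- by rewrite s0 sA.
- by rewrite (perm_size eq.1).
move=> i; apply/eqP; rewrite -(eqn_add2r (i == first_short K (RS w))).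
by rewrite -(row_len_uninsert i tA uA cj) add_max_row_len.
Qed.

Lemma words_add_max_le K m w : uniq w -> all (ltn^~ m) w ->
  size (words (size w) (RS w)) <= size (words (size w).+1 (add_max K m (RS w))).
Proof.
move=> uw lt; have [tA pm uA sA cj] := RS_add_max K uw lt.
by rewrite -(words_uninsert_add_max K uw lt) words_le.
Qed.

Lemma nth_words_add_max K m w i : uniq w -> all (ltn^~ m) w ->
  i < size (words (size w).+1 (add_max K m (RS w))) ->
  let w' := nth [::] (words (size w).+1 (add_max K m (RS w))) i in
  [/\ uniq w', RS w' = add_max K m (RS w) & perm_eq w' (m :: w)].
Proof.
move=> uw lt ilt; have [tA pm uA sA cj] := RS_add_max K uw lt.
have [u' e'] := words_RS tA uA sA (mem_nth [::] ilt); split=> //.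
have h := (RS_chain_equiv u').2.1; rewrite e' perm_sym in h; exact: perm_trans h pm.
Qed.

Lemma index_words w : uniq w ->
  index w (words (size w) (RS w)) < size (words (size w) (RS w)).
Proof. by move=> uw; rewrite index_mem RS_words. Qed.

Lemma grow_spec K m w : uniq w -> all (ltn^~ m) w ->
  [/\ uniq (grow K m w), RS (grow K m w) = add_max K m (RS w)
    & perm_eq (grow K m w) (m :: w)].
Proof.
move=> uw lt; apply: nth_words_add_max => //.
by apply: leq_trans (index_words uw) (words_add_max_le K uw lt).
Qed.

Lemma RS_add_max_inj K m w1 w2 : uniq w1 -> uniq w2 -> all (ltn^~ m) w1 ->
  all (ltn^~ m) w2 ->
  add_max K m (RS w1) = add_max K m (RS w2) -> RS w1 = RS w2.
Proof.
move=> u1 u2 l1 l2; have [t1 e1] := RS_chain_equiv u1; have [t2 e2] := RS_chain_equiv u2.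
apply: add_max_inj => //; rewrite ?(perm_mem e1.1) ?(perm_mem e2.1).
  by have /andP[] := unique_cons_max u1 l1.
by have /andP[] := unique_cons_max u2 l2.
Qed.

(** The tableau of the image determines that of the word, by deleting the new
    maximum; the rank in the list of words then determines the word. *)
Lemma grow_inj K m w1 w2 : uniq w1 -> uniq w2 -> all (ltn^~ m) w1 -> all (ltn^~ m) w2 ->
  size w1 = size w2 -> grow K m w1 = grow K m w2 -> w1 = w2.
Proof.
move=> u1 u2 l1 l2 sz e; have [_ r1 _] := grow_spec K u1 l1;
  have [_ r2 _] := grow_spec K u2 l2.
have er : RS w1 = RS w2 by apply: (@RS_add_max_inj K m) => //; rewrite -r1 -r2 e.
have [tA pm uA sA _] := RS_add_max K u1 l1.
move: e; rewrite /grow -sz -er => /eqP; rewrite nth_uniq; first 1 last.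
- by apply: leq_trans (index_words u1) (words_add_max_le K u1 l1).
- by rewrite er sz (leq_trans (index_words u2)) // words_add_max_le.
- exact: words_uniq.
move/eqP=> ei; have := RS_words u2; rewrite -sz -er => h2.
by rewrite -(nth_index [::] (RS_words u1)) ei nth_index.
Qed.

Lemma add_max_avoids K L m w w' : 0 < K -> uniq w -> uniq w' -> avoids K L w ->
  size w < K * L -> RS w' = add_max K m (RS w) -> avoids K L w'.
Proof.
move=> K0 uw uw' /(avoids_shape _ _ uw)[h1 h2] lt e; apply/avoids_shape => //.
have [tT eq] := RS_chain_equiv uw.
by rewrite e add_max_head // size_add_max geq_max h2 first_short_lt // (perm_size eq.1).
Qed.

(** The reading word of the old tableau is a subword of that of the new one. *)
Lemma add_max_bicrucial_word K L m w w' : 0 < K -> uniq w -> uniq w' ->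
  bicrucial_word K L w -> size w < K * L ->
  RS w' = add_max K m (RS w) -> bicrucial_word K L w'.
Proof.
move=> K0 uw uw' bw lt e; have av' := add_max_avoids K0 uw uw' bw.1 lt e.
have [tT eq] := RS_chain_equiv uw; have [tT' eq'] := RS_chain_equiv uw'.
apply: (bicrucial_word_chain_equiv eq');
  apply: bicrucial_word_mono (bicrucial_word_chain_equiv (chain_equiv_sym eq) bw).
  by rewrite e; apply: add_max_subseq.
exact: avoids_chain_equiv (chain_equiv_sym eq') av'.
Qed.

(** Extending on the right by a new maximum can only create an increasing pattern,
    and by a new minimum only a decreasing one, so both bounds are attained. *)
Lemma bicrucial_word_shape K L m w : 0 < K -> 0 < L -> uniq w -> all (ltn 0) w ->
  all (ltn^~ m) w -> bicrucial_word K L w -> size (head [::] (RS w)) = K /\ size (RS w) = L.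
Proof.
move=> K0 L0 uw pos lt [av ext]; have [tT eq] := RS_chain_equiv uw.
have [h1 h2] := (avoids_shape _ _ uw).1 av.
have av' := avoids_chain_equiv (chain_equiv_sym eq) av.
split; apply/eqP; rewrite eqn_leq ?h1 ?h2 /=.
  have [|[h|h] _] := ext m; first by have /andP[] := unique_cons_max uw lt.
    apply: bounded_chain (reading_incr_bounded tT) _.
    by apply/(chain_equiv_chain _ eq).1; apply: chain_belast h; apply: ltn_trans.
  exfalso; move: h; apply/boundedP; rewrite -cats1; apply: bounded_cat_max av.2 _.
  - exact: gtn_trans.
  - by move=> x y xw; rewrite inE => /eqP-> /=; rewrite -leqNgt ltnW //; apply: (allP lt).
  - by move=> s /size_subseq /= h _; apply: leq_trans h L0.
have [|[h|h] _] := ext 0; first by apply/negP=> /(allP pos).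
  exfalso; move: h; apply/boundedP; rewrite -cats1; apply: bounded_cat_max av.1 _.
  - exact: ltn_trans.
  - by move=> x y xw; rewrite inE => /eqP->.
  - by move=> s /size_subseq /= h _; apply: leq_trans h K0.
apply: bounded_chain (reading_decr_bounded tT) _.
by apply/(chain_equiv_chain _ eq).2; apply: chain_belast h; apply: gtn_trans.
Qed.

(** If the last row is not the row that received the new cell, it ends in a second
    corner. Otherwise the new cell is in row [L.-1]; the rows above are full and
    this one is not, so that row [L.-2] ends in a second corner. *)
Lemma second_corner K L m w : 0 < K -> 1 < L -> uniq w -> all (ltn 0) w ->
  all (ltn^~ m) w -> bicrucial_word K L w -> (size w).+1 < K * L ->
  exists2 i, i != first_short K (RS w) &
    row_len (add_max K m (RS w)) i.+1 < row_len (add_max K m (RS w)) i.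
Proof.
move=> K0 L1 uw pos lt bw sz.
have [hK hL] := bicrucial_word_shape K0 (ltnW L1) uw pos lt bw.
have [tT eq] := RS_chain_equiv uw; have szT := perm_size eq.1.
have [tA pm uA sA cj] := RS_add_max K uw lt.
have jL : first_short K (RS w) < L by apply: first_short_lt; rewrite ?hL // szT ltnW.
have sizeA : size (add_max K m (RS w)) = L by rewrite size_add_max hL (maxn_idPl jL).
have shL : row_len (add_max K m (RS w)) L = 0 by rewrite /row_len nth_default // sizeA.
case: (ltnP (first_short K (RS w)).+1 L) => jL'.
  exists L.-1; first by lia.
  by rewrite prednK ?(ltnW L1) // shL row_len_gt0 // sizeA prednK // ltnW.
have ej : first_short K (RS w) = L.-1 by lia.
exists L.-2; first by lia.
have -> : L.-2.+1 = L.-1 by lia.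
have before i : i < L.-1 -> K <= row_len (RS w) i.
  by rewrite -ej => /(before_find [::]) /= /negbT; rewrite -leqNgt.
rewrite !add_max_row_len ej eqxx (_ : L.-2 == L.-1 = false); last by lia.
rewrite addn0 addn1.
apply: leq_trans (before L.-2 _); last by lia.
(* if the last row had become full, the tableau would be the whole rectangle *)
rewrite ltnNge; apply/negP=> le; move: sz; rewrite ltnNge => /negP; apply.
rewrite -sA mulnC -sizeA; apply: size_full.
apply/(all_nthP [::]) => i; rewrite sizeA => iL;
  rewrite -/(row_len _ _) add_max_row_len ej.
case: (ltnP i L.-1) => [/before h|h]; first by rewrite (leq_trans h) // leq_addr.
by have -> : i = L.-1 by [lia]; rewrite eqxx addn1; lia.
Qed.

(** The tableau with the new maximum has strictly more words than the original
    one, and its surplus words are not images. *)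
Lemma grow_not_onto K L m w : 0 < K -> 1 < L -> uniq w -> all (ltn 0) w ->
  all (ltn^~ m) w -> bicrucial_word K L w -> (size w).+1 < K * L ->
  exists w', [/\ bicrucial_word K L w', perm_eq w' (m :: w)
    & forall v, perm_eq v w -> grow K m v <> w'].
Proof.
move=> K0 L1 uw pos lt bw sz.
have [i ij ci] := second_corner K0 L1 uw pos lt bw sz.
have [tA pm uA sA cj] := RS_add_max K uw lt.
have slt : size (words (size w) (RS w)) < size (words (size w).+1 (add_max K m (RS w))).
  by rewrite -(words_uninsert_add_max K uw lt); apply: words_lt ci ij.
have [u' e' p'] := nth_words_add_max uw lt slt.
exists (nth [::] (words (size w).+1 (add_max K m (RS w))) (size (words (size w) (RS w)))).
split=> //; first exact: (add_max_bicrucial_word K0 uw u' bw (ltnW sz) e').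
move=> v pv; have uv : uniq v by rewrite (perm_uniq pv).
have lv : all (ltn^~ m) v by rewrite (perm_all _ pv).
have [_ rv _] := grow_spec K uv lv; move=> e.
have er : RS v = RS w by apply: (@RS_add_max_inj K m) => //; rewrite -rv e.
move: e; rewrite /grow er (perm_size pv) => /eqP; rewrite nth_uniq //;
  last exact: words_uniq.
  by have := index_words uv; rewrite er (perm_size pv) => /ltn_eqF ->.
by have := index_words uv; rewrite er (perm_size pv) => /ltn_trans; apply.
Qed.

(** * Words made of decreasing layers *)

(** Odd letters leave the even numbers for the letters used in extensions. *)
Definition odds (b c : nat) : seq nat := [seq i.*2.+1 | i <- iota b c].

Definition layer (b c : nat) : seq nat := rev (odds b c).

Lemma odds_cat b c d : odds b (c + d) = odds b c ++ odds (b + c) d.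
Proof. by rewrite /odds iotaD map_cat. Qed.

Lemma size_odds b c : size (odds b c) = c.
Proof. by rewrite size_map size_iota. Qed.

Lemma mem_odds b c x : x \in odds b c -> b.*2 < x < (b + c).*2.
Proof. by case/mapP=> i; rewrite mem_iota => h ->; lia. Qed.

Lemma odds_sorted b c : sorted ltn (odds b c).
Proof.
rewrite sorted_map; apply: sub_sorted (iota_ltn_sorted b c) => x y /=.
by lia.
Qed.

Lemma odds_uniq b c : uniq (odds b c).
Proof. exact: sorted_uniq ltn_trans ltnn _ (odds_sorted b c). Qed.

Lemma mem_layer b c x : x \in layer b c -> b.*2 < x < (b + c).*2.
Proof. by rewrite mem_rev => /mem_odds. Qed.

Lemma layer_sorted b c : sorted gtn (layer b c).
Proof. by rewrite rev_sorted odds_sorted. Qed.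

Lemma size_layer b c : size (layer b c) = c.
Proof. by rewrite size_rev size_odds. Qed.

Lemma perm_layer b c : perm_eq (layer b c) (odds b c).
Proof. by rewrite perm_rev. Qed.

Lemma bounded_size R w : bounded R (size w) w.
Proof. by move=> s sub _; apply: size_subseq. Qed.

Lemma decr_bounded w : sorted gtn w -> bounded ltn 1 w.
Proof. by apply: bounded_anti gtn_trans ltn_trans _ => x y /= yx;
  rewrite -leqNgt ltnW. Qed.

Lemma incr_bounded w : sorted ltn w -> bounded gtn 1 w.
Proof. by apply: bounded_anti ltn_trans gtn_trans _ => x y /= yx;
  rewrite -leqNgt ltnW. Qed.

(** A bicrucial word of length [K + 2 * L - 2]: a decreasing layer of [L] small
    letters, an increasing run of [K - 2] letters, a decreasing layer of [L] great
    letters. The first letter of the word starts both a decreasing sequence of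
    length [L] and an increasing one of length [K]; the last letter ends two such
    sequences. A new letter placed before or after the word therefore prolongs one
    of them. *)
Definition base_word (K L : nat) : seq nat :=
  layer 0 L ++ odds L (K - 2) ++ layer (L + (K - 2)) L.

Lemma base_word_perm K L : perm_eq (base_word K L) (odds 0 (L + (K - 2) + L)).
Proof.
rewrite -addnA !odds_cat add0n; apply: perm_cat; first exact: perm_layer.
by apply: perm_cat => //; apply: perm_layer.
Qed.

Lemma base_word_avoids K L : 1 < K -> 0 < L -> avoids K L (base_word K L).
Proof.
move=> K1 L0; split.
  have -> : K = 1 + (K - 2 + 1) by lia.
  apply: bounded_cat ltn_trans _ _; first exact/decr_bounded/layer_sorted.
  apply: bounded_cat ltn_trans _ _; last exact/decr_bounded/layer_sorted.
  by rewrite -[X in bounded _ X](size_odds L);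
    have -> : 1 + (K - 2 + 1) - 2 = K - 2 by [lia]; apply: bounded_size.
apply: bounded_cat_max gtn_trans _ _ _.
- move=> x y /mem_layer xb; rewrite mem_cat => /orP[/mem_odds|/mem_layer] yb /=; lia.
- by rewrite -[X in bounded _ X](size_layer 0); apply: bounded_size.
apply: bounded_cat_max gtn_trans _ _ _.
- by move=> x y /mem_odds xb /mem_layer yb /=; lia.
- by apply: bounded_leq L0 (incr_bounded (odds_sorted _ _)).
by rewrite -[X in bounded _ X](size_layer (L + (K - 2))); apply: bounded_size.
Qed.

Lemma mem_odds_intro b c i : b <= i < b + c -> i.*2.+1 \in odds b c.
Proof. by move=> h; apply/mapP; exists i; rewrite ?mem_iota. Qed.

(** One letter of the first layer, the middle run, and one letter of the last
    layer are consecutive odd numbers. *)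
Lemma base_word_subseq K L : 1 < K -> 0 < L -> subseq (odds L.-1 K) (base_word K L).
Proof.
move=> K1 L0;
  have -> : odds L.-1 K = odds L.-1 1 ++ odds L (K - 2) ++ odds (L + (K - 2)) 1.
  have := odds_cat L.-1 1 (K - 2 + 1); rewrite (_ : L.-1 + 1 = L); last by lia.
  by rewrite -odds_cat => <-; congr odds; lia.
apply: cat_subseq; last apply: cat_subseq => //.
  by rewrite sub1seq mem_rev; apply: mem_odds_intro; lia.
by rewrite sub1seq mem_rev; apply: mem_odds_intro; lia.
Qed.

Lemma chain_rcons (R : rel nat) s w t : transitive R -> sorted R s -> subseq s w ->
  all (R^~ t) s -> chain R (size s).+1 (rcons w t).
Proof.
move=> Rt ss sub al; exists (rcons s t); split; last by rewrite size_rcons.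
  by rewrite -!cats1 cat_subseq.
by rewrite -cats1 (sorted_catP _ _ Rt) ss allrel1r al.
Qed.

Lemma chain_cons (R : rel nat) s w t : transitive R -> sorted R s -> subseq s w ->
  all (R t) s -> chain R (size s).+1 (t :: w).
Proof.
move=> Rt ss sub al; exists (t :: s); split; rewrite /= ?eqxx //.
by rewrite (path_sortedE Rt) al.
Qed.

Lemma base_word_bicrucial K L : 1 < K -> 0 < L -> bicrucial_word K L (base_word K L).
Proof.
move=> K1 L0; split=> [|t tw]; first exact: base_word_avoids.
have sub := base_word_subseq K1 L0.
have srt := odds_sorted L.-1 K.
have sz : size (odds L.-1 K) = K by rewrite size_odds.
have s1 : subseq (layer 0 L) (base_word K L) by apply: prefix_subseq.
have s2 : subseq (layer (L + (K - 2)) L) (base_word K L).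
  by rewrite /base_word catA; apply: suffix_subseq.
split.
  have : t != (L + (K - 2)).*2.+1.
    apply: contraNneq tw => ->; apply: (mem_subseq s2); rewrite mem_rev.
    by apply: mem_odds_intro; lia.
  rewrite neq_ltn => /orP[lt|lt]; [right|left].
    rewrite -[in X in chain _ X](size_layer (L + (K - 2)) L).
    apply: chain_rcons gtn_trans (layer_sorted _ _) s2 _.
    by apply/allP=> x /mem_layer xb /=; lia.
  rewrite -[in X in chain _ X]sz; apply: chain_rcons ltn_trans srt sub _.
  by apply/allP=> x /mem_odds xb /=; lia.
have : t != L.-1.*2.+1.
  apply: contraNneq tw => ->; apply: (mem_subseq s1); rewrite mem_rev.
  by apply: mem_odds_intro; lia.
rewrite neq_ltn => /orP[lt|lt]; [left|right].
  rewrite -[in X in chain _ X]sz; apply: chain_cons ltn_trans srt sub _.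
  by apply/allP=> x /mem_odds xb /=; lia.
rewrite -[in X in chain _ X](size_layer 0 L).
apply: chain_cons gtn_trans (layer_sorted _ _) s1 _.
by apply/allP=> x /mem_layer xb /=; lia.
Qed.

Fixpoint stack (K L : nat) : seq nat :=
  if K is K'.+1 then stack K' L ++ layer (K' * L) L else [::].

Lemma stack_perm K L : perm_eq (stack K L) (odds 0 (K * L)).
Proof.
elim: K => //= K IH; rewrite mulSn addnC odds_cat.
by apply: perm_cat IH _; apply: perm_layer.
Qed.

Lemma stack_incr K L : bounded ltn K (stack K L).
Proof.
elim: K => [|K IH] /=; first exact: bounded_size.
rewrite -addn1; apply: bounded_cat ltn_trans IH _.
exact/decr_bounded/layer_sorted.
Qed.

Lemma stack_decr K L : bounded gtn L (stack K L).
Proof.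
elim: K => [|K IH] /=; first by move=> s /size_subseq /= h _; apply: leq_trans h _.
apply: bounded_cat_max gtn_trans _ IH _.
  move=> x y; rewrite (perm_mem (stack_perm K L)) => /mem_odds xb /mem_layer yb /=; lia.
by rewrite -[X in bounded _ X](size_layer (K * L)); apply: bounded_size.
Qed.

(** A word of length [K * L - 1] that avoids both patterns and still does after
    appending the letter that completes its last layer; so it is not bicrucial. *)
Definition stuck_word (K L : nat) : seq nat := stack K.-1 L ++ layer (K.-1 * L) L.-1.

Lemma stuck_word_perm K L : 0 < K -> 0 < L ->
  perm_eq (stuck_word K L) (odds 0 (K * L).-1).
Proof.
move=> K0 L0; have -> : (K * L).-1 = K.-1 * L + L.-1 by nia.
by rewrite odds_cat; apply: perm_cat (stack_perm _ _) _; apply: perm_layer.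
Qed.

Lemma stuck_word_extends K L : 0 < K -> 0 < L ->
  avoids K L (rcons (stuck_word K L) (K.-1 * L).*2).
Proof.
move=> K0 L0; rewrite /stuck_word rcons_cat.
have srt : sorted gtn (rcons (layer (K.-1 * L) L.-1) (K.-1 * L).*2).
  rewrite -cats1 (sorted_catP _ _ gtn_trans) layer_sorted allrel1r andbT.
  by apply/allP=> x /mem_layer /= xb; lia.
split.
  rewrite -[X in bounded _ X](prednK K0) -addn1.
  apply: bounded_cat ltn_trans _ _; first exact: stack_incr.
  exact: decr_bounded.
apply: bounded_cat_max gtn_trans _ (@stack_decr _ _) _.
  move=> x y; rewrite (perm_mem (stack_perm _ L)) => /mem_odds xb.
  by rewrite mem_rcons inE => /predU1P[->|/mem_layer yb] /=; lia.
rewrite -[X in bounded _ X](prednK L0) -{1}(size_layer (K.-1 * L) L.-1).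
by rewrite -(size_rcons _ (K.-1 * L).*2); apply: bounded_size.
Qed.

Lemma avoids_sub K L w w' : subseq w w' -> avoids K L w' -> avoids K L w.
Proof. by move=> sub [h1 h2]; split=> s sw; [apply: h1|apply: h2];
  apply: subseq_trans sub. Qed.

Lemma avoids_hits K L w : avoids K L w -> ~ hits K L w.
Proof. by move=> [/boundedP h1 /boundedP h2] []. Qed.

Lemma odds_odd b c t : t \in odds b c -> odd t.
Proof. by case/mapP=> i _ -> /=; rewrite odd_double. Qed.

Lemma stuck_word_not_bicrucial K L : 0 < K -> 0 < L ->
  ~ bicrucial_word K L (stuck_word K L).
Proof.
move=> K0 L0 [_ ext]; have [|h _] := ext (K.-1 * L).*2.
  by rewrite (perm_mem (stuck_word_perm K0 L0)); apply/negP=> /odds_odd;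
    rewrite odd_double.
exact: avoids_hits (stuck_word_extends K0 L0) h.
Qed.

(** * The injection is not onto *)

Lemma odds_facts n w : perm_eq w (odds 0 n) ->
  [/\ uniq w, all (ltn 0) w, all (ltn^~ n.*2.+1) w & size w = n].
Proof.
move=> pw; split; rewrite ?(perm_uniq pw) ?odds_uniq ?(perm_all _ pw) //.
- by apply/allP=> x /mem_odds /=; lia.
- by apply/allP=> x /mem_odds /=; lia.
- by rewrite (perm_size pw) size_odds.
Qed.

Lemma perm_odds_cons n w w' : perm_eq w (odds 0 n) -> perm_eq w' (n.*2.+1 :: w) ->
  perm_eq w' (odds 0 n.+1).
Proof.
move=> pw pw'; apply: (perm_trans pw'); rewrite perm_sym.
have -> : odds 0 n.+1 = rcons (odds 0 n) n.*2.+1 by rewrite -cats1 -(addn1 n) odds_cat.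
by rewrite perm_rcons perm_cons perm_sym.
Qed.

(** Starting from [base_word], the injection [grow] produces one more letter at a
    time until the rectangle is full. *)
Lemma exists_bicrucial_word K L n : 1 < K -> 1 < L -> K + L.*2 - 2 <= n <= K * L ->
  exists2 w, perm_eq w (odds 0 n) & bicrucial_word K L w.
Proof.
move=> K1 L1; elim: n => [|n IH] /andP[lo hi]; first by lia.
move: lo; rewrite leq_eqVlt => /predU1P[<-|lt].
  exists (base_word K L); last by apply: base_word_bicrucial => //; apply: ltnW.
  by rewrite (_ : K + L.*2 - 2 = L + (K - 2) + L) ?base_word_perm //; lia.
have [|w pw bw] := IH; first by rewrite -ltnS lt ltnW.
have [uw _ lw sw] := odds_facts pw.
have [u' e' p'] := grow_spec K uw lw.
exists (grow K n.*2.+1 w); first exact: perm_odds_cons pw p'.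
by apply: (add_max_bicrucial_word _ uw u' bw _ e'); rewrite ?sw // ltnW.
Qed.

(** Below length [K * L - 1] this is [grow_not_onto]. At length [K * L - 1] the
    tableau with the new maximum is a rectangle and has a single corner, so that
    argument fails; but there every avoiding word of length [K * L] is bicrucial,
    in particular the image of [stuck_word], whose only preimage is not. *)
Lemma grow_misses K L n : 1 < K -> 1 < L -> K + L.*2 - 2 <= n < K * L ->
  exists w', [/\ perm_eq w' (odds 0 n.+1), bicrucial_word K L w' &
    forall v, perm_eq v (odds 0 n) -> bicrucial_word K L v -> grow K n.*2.+1 v <> w'].
Proof.
move=> K1 L1 /andP[lo hi]; have K0 := ltnW K1; have L0 := ltnW L1.
case: (ltnP n.+1 (K * L)) => lt.
  have [|w pw bw] := @exists_bicrucial_word K L n K1 L1; first by rewrite lo ltnW.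
  have [uw posw lw sw] := odds_facts pw.
  have [|w' [bw' pw' h]] := grow_not_onto K0 L1 uw posw lw bw; first by rewrite sw.
  exists w'; split=> //; first exact: perm_odds_cons pw pw'.
  by move=> v pv _; apply: h; apply: perm_trans pv _; rewrite perm_sym.
have en : (K * L).-1 = n by lia.
have := stuck_word_perm K0 L0; rewrite en => pw.
have [uw _ lw sw] := odds_facts pw.
have av : avoids K L (stuck_word K L).
  by apply: avoids_sub (stuck_word_extends K0 L0); apply: subseq_rcons.
have [u' e' p'] := grow_spec K uw lw.
exists (grow K n.*2.+1 (stuck_word K L)); split; first exact: perm_odds_cons pw p'.
  apply: bicrucial_word_full => //; first by rewrite (perm_size p') /= sw; lia.
  by apply: (add_max_avoids K0 uw u' av _ e'); rewrite sw.
move=> v pv bv e; have [uv _ lv sv] := odds_facts pv.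
have ev : v = stuck_word K L by apply: (grow_inj uv uw lv lw _ e); rewrite sv sw.
by apply: (stuck_word_not_bicrucial K0 L0); rewrite -ev.
Qed.

(** * Permutations as words *)

Definition values (n : nat) (s : 'S_n) : seq nat := [seq val (s i) | i <- enum 'I_n].

Definition odd_word (n : nat) (s : 'S_n) : seq nat := [seq x.*2.+1 | x <- values s].

Lemma enum_ord_sorted n : sorted (relpre val ltn) (enum 'I_n).
Proof. by rewrite -sorted_map val_enum_ord iota_ltn_sorted. Qed.

(** An embedding of indices is the same as a subsequence of the word of values. *)
Lemma contains_chain n m (R : rel nat) (g : 'I_n -> nat) : transitive R ->
  [exists f : {ffun 'I_m -> 'I_n}, forall i : 'I_m, forall j : 'I_m,
     (i < j) ==> (f i < f j) && R (g (f i)) (g (f j))]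
  <-> chain R m [seq g i | i <- enum 'I_n].
Proof.
move=> Rt; have rt : transitive (relpre (@nat_of_ord n) ltn).
  by move=> x y z /=; apply: ltn_trans.
split=> [/existsP[f /forallP h]|[s [/subseqP[b _ ->]]]].
  have {}h (i j : 'I_m) : i < j -> (f i < f j) && R (g (f i)) (g (f j)).
    by move/forallP: (h i) => /(_ j) /implyP.
  exists [seq g (f i) | i <- enum 'I_m]; split.
  - rewrite (map_comp g f); apply: map_subseq.
    set u := map f _;
      suff -> : u = [seq x <- enum 'I_n | x \in u] by apply: filter_subseq.
    apply: (irr_sorted_eq rt).
    + by move=> x; rewrite /= ltnn.
    + by apply: homo_sorted (enum_ord_sorted m) => i j /h/andP[].
    + exact: sorted_filter rt _ _ (enum_ord_sorted n).
    + by move=> x; rewrite mem_filter mem_enum andbT.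
  - rewrite sorted_map; apply: sub_sorted (enum_ord_sorted m) => i j /=.
    by move/h/andP=> [].
  - by rewrite size_map size_enum_ord.
rewrite -map_mask sorted_map size_map => srt sz.
set e := mask b _ in srt sz.
have srt2 : sorted (relpre val ltn) e.
  by apply: subseq_sorted (enum_ord_sorted n); [exact: rt|exact: mask_subseq].
have sz' : size e == m by apply/eqP.
apply/existsP; exists [ffun i => tnth (Tuple sz') i].
apply/forallP=> i; apply/forallP=> j; apply/implyP=> ij; rewrite !ffunE.
have x0 := tnth (Tuple sz') i; rewrite !(tnth_nth x0) /=.
have lt (k : 'I_m) : k < size e by rewrite (eqP sz').
apply/andP; split.
  by apply: (sorted_ltn_nth rt x0 srt2) ij; rewrite inE lt.
have gt : transitive (relpre g R) by move=> ? ? ?; apply: Rt.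
by apply: (sorted_ltn_nth gt x0 srt) ij; rewrite inE lt.
Qed.

Lemma contains_incrP m n (s : 'S_n) : contains_incr m s <-> chain ltn m (values s).
Proof. exact: (contains_chain _ (fun i => val (s i)) ltn_trans). Qed.

Lemma contains_decrP m n (s : 'S_n) : contains_decr m s <-> chain gtn m (values s).
Proof. exact: (contains_chain _ (fun i => val (s i)) gtn_trans). Qed.

Lemma hits_map K L (g : nat -> nat) w : {mono g : x y / x < y} ->
  hits K L (map g w) <-> hits K L w.
Proof.
by move=> gm; rewrite /hits !chain_map // => x y /=; apply: gm.
Qed.

Lemma contains_hits K L n (s : 'S_n) :
  contains_id_or_rev K.+1 L.+1 s <-> hits K L (values s).
Proof.
rewrite /contains_id_or_rev /hits -contains_incrP -contains_decrP.
by split=> [/orP|h]; last exact/orP.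
Qed.

(** Sends the values of an extension by [t] to the odd letters of the original
    permutation and the even letter of the gap where [t] is inserted. *)
Definition gap (t y : nat) : nat :=
  if y < t then y.*2.+1 else if y == t then t.*2 else y.*2.-1.

Lemma gap_mono t : {mono gap t : x y / x < y}.
Proof. by move=> x y; rewrite /gap; case: (ltngtP x t) => ?; case: (ltngtP y t) => ?;
  apply/idP/idP; lia. Qed.

Lemma gap_lift n (t : 'I_n.+1) (x : 'I_n) : gap t (lift t x) = x.*2.+1.
Proof. by rewrite /gap /= /bump; case: (leqP t x) => h; rewrite ?add0n ?add1n;
  case: ltngtP; lia. Qed.

Lemma gap_id t : gap t t = t.*2.
Proof. by rewrite /gap ltnn eqxx. Qed.

Lemma gap_ext_right n (s : 'S_n) (t : 'I_n.+1) :
  map (gap t) (values (ext_right s t)) = rcons (odd_word s) t.*2.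
Proof.
rewrite /odd_word /values /ext_right enum_ordSr !map_rcons lift_perm_id gap_id -!map_comp.
congr rcons; apply: eq_map => i /=.
have -> : widen_ord (leqnSn n) i = lift ord_max i by apply/val_inj/esym/lift_max.
by rewrite lift_perm_lift gap_lift.
Qed.

Lemma gap_ext_left n (s : 'S_n) (t : 'I_n.+1) :
  map (gap t) (values (ext_left s t)) = t.*2 :: odd_word s.
Proof.
rewrite /odd_word /values /ext_left enum_ordSl /= lift_perm_id gap_id -!map_comp.
by congr cons; apply: eq_map => i /=; rewrite lift_perm_lift gap_lift.
Qed.

Lemma odd_word_perm n (s : 'S_n) : perm_eq (odd_word s) (odds 0 n).
Proof.
apply: perm_map; apply: uniq_perm; rewrite ?iota_uniq //.
  by rewrite map_inj_uniq ?enum_uniq // => i j /val_inj/perm_inj.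
move=> x; rewrite mem_iota add0n /=; apply/mapP/idP=> [[i _ ->]|xn]; first exact: ltn_ord.
by exists (s^-1%g (Ordinal xn)); rewrite ?mem_enum // permKV.
Qed.

Lemma odd_word_inj n : injective (@odd_word n).
Proof.
move=> s1 s2 /inj_map e; have {e} : values s1 = values s2.
  by apply: e => x y /succn_inj /double_inj.
move/eq_in_map=> e; apply/permP=> i; apply/val_inj.
by apply: e; rewrite mem_enum.
Qed.

Lemma odd_word_surj n w : perm_eq w (odds 0 n) -> exists s : 'S_n, odd_word s = w.
Proof.
move=> pw; pose u := map half w.
have pu : perm_eq u (iota 0 n).
  rewrite (perm_trans (perm_map half pw)) // -map_comp.
  by rewrite (eq_map (g := id)) ?map_id // => x /=; rewrite uphalf_double.
have uu : uniq u by rewrite (perm_uniq pu) iota_uniq.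
have su : size u = n by rewrite (perm_size pu) size_iota.
have lt (i : 'I_n) : nth 0 u i < n.
  have : nth 0 u i \in u by rewrite mem_nth // su.
  by rewrite (perm_mem pu) mem_iota.
have inj : injective (fun i => Ordinal (lt i)).
  move=> i j /(congr1 val) /= /eqP; rewrite nth_uniq ?su // => /eqP.
  exact: val_inj.
exists (perm inj).
have -> : odd_word (perm inj) = [seq x.*2.+1 | x <- u].
  congr map; rewrite /values -[RHS](mkseq_nth 0) su /mkseq -val_enum_ord -map_comp.
  by apply: eq_map => i; rewrite permE.
rewrite -map_comp -[RHS]map_id; apply/eq_in_map=> x.
rewrite (perm_mem pw) => /odds_odd ox /=.
by rewrite -[RHS]odd_double_half ox.
Qed.

(** Raising all letters from [N] on by the same amount keeps their order, so all
    letters above the whole word have the same effect. *)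
Lemma hits_stretch K L N t w : N <= t -> all (ltn^~ N) w ->
  (hits K L (rcons w N) <-> hits K L (rcons w t)) /\
  (hits K L (N :: w) <-> hits K L (t :: w)).
Proof.
move=> Nt lt; pose h y := if y < N then y else y + (t - N).
have hm : {mono h : x y / x < y} by move=> x y; rewrite /h; case: (ltnP x N);
  case: (ltnP y N); lia.
have hw : map h w = w.
  by rewrite -[RHS]map_id; apply/eq_in_map=> x /(allP lt) /= xN; rewrite /h xN.
have hN : h N = t by rewrite /h ltnn subnKC.
have := hits_map K L (rcons w N) hm; have := hits_map K L (N :: w) hm.
by rewrite map_rcons /= hw hN => h1 h2; split; symmetry.
Qed.

Lemma bicrucialP K L n (s : 'S_n) :
  bicrucial K.+1 L.+1 s <-> bicrucial_word K L (odd_word s).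
Proof.
have rP (t : 'I_n.+1) :
  contains_id_or_rev K.+1 L.+1 (ext_right s t) <-> hits K L (rcons (odd_word s) t.*2).
  by rewrite contains_hits -gap_ext_right; symmetry; apply: hits_map; apply: gap_mono.
have lP (t : 'I_n.+1) :
  contains_id_or_rev K.+1 L.+1 (ext_left s t) <-> hits K L (t.*2 :: odd_word s).
  by rewrite contains_hits -gap_ext_left; symmetry; apply: hits_map; apply: gap_mono.
have aP : ~~ contains_incr K.+1 s && ~~ contains_decr L.+1 s <-> avoids K L (odd_word s).
  have om : {mono (fun x => x.*2.+1) : x y / x < y} by move=> x y; lia.
  rewrite /avoids !boundedP /odd_word !chain_map; try by move=> x y /=; apply: om.
  rewrite -contains_incrP -contains_decrP;
    split=> [/andP[/negP h1 /negP h2]//|[/negP-> /negP->]//].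
have [uw _ lt _] := odds_facts (odd_word_perm s).
split=> [/and4P[a1 a2 /forallP rt /forallP lf]|[/aP/andP[a1 a2] ext]]; last first.
  have tw (t : 'I_n.+1) : t.*2 \notin odd_word s.
    by rewrite (perm_mem (odd_word_perm s)); apply/negP=> /odds_odd; rewrite odd_double.
  by apply/and4P; split=> //; apply/forallP=> t; [apply/rP|apply/lP];
    case: (ext _ (tw t)).
split=> [|t tw]; first by apply/aP; rewrite a1.
case: (ltnP t n.*2) => tn.
  (* odd numbers below n.*2 are letters of the word *)
  have te : t = t./2.*2.
    rewrite -[LHS]odd_double_half; case ot: (odd t) => //.
    case/negP: tw; rewrite (perm_mem (odd_word_perm s)) -[t]odd_double_half ot.
    by apply: mem_odds_intro; lia.
  have tn' : t./2 < n.+1 by lia.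
  rewrite te; split; first by apply/(rP (Ordinal tn')).
  by apply/(lP (Ordinal tn')).
have lt' : all (ltn^~ n.*2) (odd_word s).
  by rewrite (perm_all _ (odd_word_perm s)); apply/allP=> x /mem_odds /=; lia.
have [e1 e2] := hits_stretch K L tn lt'.
split; first by apply/e1/(rP ord_max).
by apply/e2/(lP ord_max).
Qed.

Definition grow_perm (K n : nat) (s : 'S_n) : 'S_n.+1 :=
  odflt 1%g [pick s' | odd_word s' == grow K n.*2.+1 (odd_word s)].

Lemma odd_word_grow_perm K n (s : 'S_n) :
  odd_word (grow_perm K s) = grow K n.*2.+1 (odd_word s).
Proof.
have [uw _ lt _] := odds_facts (odd_word_perm s).
have [_ _ p'] := grow_spec K uw lt.
have [s' es'] := odd_word_surj (perm_odds_cons (odd_word_perm s) p').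
rewrite /grow_perm; case: pickP => [s'' /eqP//|/(_ s')].
by rewrite es' eqxx.
Qed.

Lemma num_bicrucial_lt K L n : 1 < K -> 1 < L -> K + L.*2 - 2 <= n < K * L ->
  num_bicrucial K.+1 L.+1 n < num_bicrucial K.+1 L.+1 n.+1.
Proof.
move=> K1 L1 nb; have [w' [pw' bw' miss]] := grow_misses K1 L1 nb.
have [s' es'] := odd_word_surj pw'.
rewrite /num_bicrucial -(@card_in_imset _ _ (@grow_perm K n)).
  apply: proper_card; apply/properP; split.
    apply/subsetP=> _ /imsetP[s bs ->]; move: bs; rewrite !inE => /bicrucialP bs.
    apply/bicrucialP; rewrite odd_word_grow_perm.
    have [uw _ lt sw] := odds_facts (odd_word_perm s).
    have [u' e' _] := grow_spec K uw lt.
    by apply: (add_max_bicrucial_word (ltnW K1) uw u' bs _ e'); rewrite sw; case/andP: nb.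
  exists s'; first by rewrite inE; apply/bicrucialP; rewrite es'.
  apply/imsetP=> -[s]; rewrite inE => /bicrucialP bs e.
  by apply: (miss _ (odd_word_perm s) bs); rewrite -odd_word_grow_perm -e.
move=> s1 s2 _ _ e; apply: odd_word_inj.
have [u1 _ l1 sz1] := odds_facts (odd_word_perm s1);
  have [u2 _ l2 sz2] := odds_facts (odd_word_perm s2).
by apply: (@grow_inj K _ _ _ u1 u2 l1 l2); rewrite ?sz1 ?sz2 // -!odd_word_grow_perm e.
Qed.

Theorem theorem24 (k l n : nat)
  (hk : 0 < k) (hl : 0 < l) (hn : 0 < n)
  (hlk : l <= k)
  (hlow : k + 2 * l <= n + 5)
  (hup : n < (k - 1) * (l - 1)) :
  num_bicrucial k l n < num_bicrucial k l n.+1.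
Proof.
(* for l <= 2 the bounds on n contradict each other *)
have l2 : 2 < l by nia.
by rewrite -(prednK hk) -(prednK hl); apply: num_bicrucial_lt; lia.
Qed.
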